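(* For every fixed $\epsilon$ with $0<\epsilon\le\frac1{100}$, with high probability, for every integer $k$ with $0\le k<\epsilon^3 n$, \[|\mathcal L_k\cap C_{\tau_{\mathrm{end}}}|\ge (1-2\epsilon)\binom nk.\]
   Context: Let $n\ge 1$ and $\mathcal B=\{0,1\}^n$ with the coordinatewise partial order; $\mathbf 0=(0,\dots,0)$, $\mathbf 1=(1,\dots,1)$, $|x|$ denotes the number of ones of $x$, and $\mathcal L_k=\{x\in\mathcal B:|x|=k\}$ is the $k$th level, so $|\mathcal L_k|=\binom nk$. A random decreasing walk from $\mathbf 1$ is a maximal chain $\mathbf 1=x_n>x_{n-1}>\dots>x_0=\mathbf 0$ with $x_i\in\mathcal L_i$, chosen uniformly among all $n!$ such chains (equivalently, each step turns a uniformly random remaining $1$ into $0$). The DLA process on $\mathcal B$: $C_0=\{\mathbf 0\}$; for $t\ge1$, let $\rho_t$ be a random decreasing walk from $\mathbf 1$, independent of everything before; let $v$ be the last vertex of the longest initial segment of $\rho_t$ that is disjoint from $C_{t-1}$, and set $C_t=C_{t-1}\cup\{v\}$. The process terminates at the first time $\tau_{\mathrm{end}}$ with $\mathbf 1\in C_{\tau_{\mathrm{end}}}$ (for $t>\tau_{\mathrm{end}}$ put $C_t=C_{\tau_{\mathrm{end}}}$). A vertex is occupied at time $t$ if it lies in $C_t$. ''With high probability'' (w.h.p.) means with probability tending to $1$ as $n\to\infty$. *)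

(* Defs.v *)
From Stdlib Require Import Reals.
From mathcomp Require Import all_boot.
From mathcomp Require Import fingroup perm.

Set Implicit Arguments.
Unset Strict Implicit.
Unset Printing Implicit Defensive.

(* A vertex x of B = {0,1}^n is encoded by its set of ones, a {set 'I_n};
   |x| = #|x|.  A maximal decreasing chain from 1 to 0 is encoded by a
   permutation s : 'S_n : step j (j = 0..n-1) turns coordinate s j to 0.
   This is a bijection between the n! chains and 'S_n, so uniform chains
   correspond to uniform permutations. *)

Definition walk_vertex n (s : 'S_n) (j : nat) : {set 'I_n} :=
  [set i | j <= (s^-1)%g i].

(* one DLA step: if 1 is already occupied the process has stopped;
   otherwise m = index of the first walk vertex in C (exists since 0 in C),
   and the last vertex of the initial segment disjoint from C is w_{m-1}. *)
Definition dla_step n (C : {set {set 'I_n}}) (s : 'S_n) : {set {set 'I_n}} :=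
  if setT \in C then C
  else
    let m := find (fun j => walk_vertex s j \in C) (iota 0 n.+1) in
    walk_vertex s m.-1 |: C.

Definition C0 n : {set {set 'I_n}} := [set set0].

Definition dla_run n T (w : {ffun 'I_T -> 'S_n}) : {set {set 'I_n}} :=
  foldl (@dla_step n) (C0 n) [seq w t | t <- enum 'I_T].

(* Every step before termination adds a new vertex, so tau_end <= 2^n - 1,
   and C_{tau_end} = C_{2^n} deterministically. *)
Definition horizon n := 2 ^ n.

Definition final_cluster n (w : {ffun 'I_(horizon n) -> 'S_n}) :=
  dla_run w.

Definition Rleb (a b : R) : bool := if Rle_dec a b then true else false.
Definition Rltb (a b : R) : bool := if Rlt_dec a b then true else false.

Definition level_count n (C : {set {set 'I_n}}) (k : nat) : nat :=
  #|[set x in C | #|x| == k]|.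

(* the event: for all k with k < eps^3 n, |L_k ∩ C_end| >= (1-2eps) C(n,k).
   (k < eps^3 n <= n forces k <= n, so k ranges over 'I_n.+1.) *)
Definition good_event n (eps : R) (w : {ffun 'I_(horizon n) -> 'S_n}) : bool :=
  [forall k : 'I_n.+1,
     Rltb (INR k) (Rmult (pow eps 3) (INR n)) ==>
     Rleb (Rmult (Rminus 1 (Rmult 2 eps)) (INR 'C(n, k)))
          (INR (level_count (final_cluster w) k))].

Definition good_prob n (eps : R) : R :=
  Rdiv (INR #|[set w : {ffun 'I_(horizon n) -> 'S_n} | good_event eps w]|)
       (INR #|{ffun 'I_(horizon n) -> 'S_n}|).

(* Main.v *)
Require Import Defs.
From Stdlib Require Import Reals.
From mathcomp Require Import all_boot.
From mathcomp Require Import fingroup perm.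
From mathcomp Require Import order ssralg ssrnum archimedean reals Rstruct.
From mathcomp Require Import sequences exp.
From mathcomp Require Import lra ring zify.

(** Put t_k = C(n,k+1)/16.  Inductively in k, at time t_k every vertex of level
    k+1 has at most a 2 eps fraction of unoccupied lower neighbours; averaging
    over level k+1 gives the density of level k.

    For y in level k, the probability that a walk through y is stopped above y is
    at most [blocking y C], the sum of 1/C(n-k,|z|-k) over occupied z > y.  No two
    of the first t_k walks meet at level n/10, by a birthday bound, so nothing
    above that level is occupied.  Hence [blocking] is dominated by a sum over the
    walks of i.i.d. variables [exposure] of size O(1/n) and mean O(1/C(n,k+1)),
    and Chernoff's bound makes it at most 1/2 for all y at once.

    If y has half of its lower neighbours occupied at time t_(k-1), each later
    walk then occupies y with probability at least 1/(4 C(n,k)).  A set S of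
    vertices of level k stays vacant up to time t_k with probability at most
    exp(- |S| (t_k - t_(k-1)) / (4 C(n,k))), which for |S| > 2 eps (k+1) is at most
    exp(- eps n / 64).  Since k < eps^3 n, this beats the number C(n,k+1) 2^(k+1)
    of candidate sets S of lower neighbours of a vertex of level k+1. *)

Set Implicit Arguments.
Unset Strict Implicit.
Unset Printing Implicit Defensive.
Import Order.TTheory GRing.Theory Num.Theory.

(** * Permutations through prescribed vertices *)

Section Walks.
Variable n : nat.
Implicit Types (s g : 'S_n) (y z : {set 'I_n}) (C : {set {set 'I_n}}).

Lemma walk_vertex_imset s j : walk_vertex s j = s @: [set i : 'I_n | j <= i].
Proof.
apply/setP => i; rewrite inE; apply/idP/imsetP => [h|[i0]].
  by exists ((s^-1)%g i); rewrite ?inE // permKV.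
by rewrite inE => h ->; rewrite permK.
Qed.

Lemma card_walk_vertex s j : #|walk_vertex s j| = n - j.
Proof.
rewrite walk_vertex_imset card_imset; last exact: perm_inj.
rewrite cardsE -sum1_card (eq_bigl (fun i : 'I_n => j <= i)) //.
rewrite -(big_mkord (fun i => j <= i) (fun _ => 1)).
by rewrite -(big_nat_widenl j 0 n predT (fun=> 1)) // sum_nat_const_nat muln1.
Qed.

Lemma walk_vertex_subset s j j' : j <= j' -> walk_vertex s j' \subset walk_vertex s j.
Proof. by move=> h; apply/subsetP => i; rewrite !inE; apply: leq_trans. Qed.

(** Right multiplication relabels the coordinates along the whole walk, since [(s * g) i] is
    [g (s i)]. *)
Lemma walk_vertex_mulg s g j : walk_vertex (s * g)%g j = g @: walk_vertex s j.
Proof.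
rewrite !walk_vertex_imset -imset_comp; apply: eq_imset => i /=.
by rewrite permM.
Qed.

Lemma imset_tperm (a b : 'I_n) z : a \in z -> b \in z -> tperm a b @: z = z.
Proof.
move=> az bz; apply/eqP; rewrite eqEcard card_imset ?leqnn ?andbT; last exact: perm_inj.
by apply/subsetP => i /imsetP [j jz ->]; case: tpermP => // ->.
Qed.

(** A walk meets level [k] exactly at step [n - k]. Indexing by level makes lying on the walk a
    single comparison, [passes]. *)
Definition level_vertex s k := walk_vertex s (n - k).
Definition passes s y := level_vertex s #|y| == y.

Lemma card_le_n y : #|y| <= n.
Proof. by rewrite -[X in _ <= X]card_ord max_card. Qed.

Lemma card_level_vertex s k : k <= n -> #|level_vertex s k| = k.
Proof. by move=> kn; rewrite card_walk_vertex subKn. Qed.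

Lemma level_vertex_subset s k k' : k <= k' -> level_vertex s k \subset level_vertex s k'.
Proof. by move=> h; apply: walk_vertex_subset; apply: leq_sub2l. Qed.

Lemma passes_level_vertex s k : k <= n -> passes s (level_vertex s k).
Proof. by move=> h; rewrite /passes card_level_vertex. Qed.

Lemma passes_eq s y : passes s y -> y = level_vertex s #|y|.
Proof. by move/eqP. Qed.

Lemma passes_mul_tperm s (a b : 'I_n) z :
  a \in z -> b \in z -> passes (s * tperm a b)%g z = passes s z.
Proof.
move=> az bz; rewrite /passes /level_vertex walk_vertex_mulg.
rewrite -[X in _ == X](imset_tperm az bz); apply: (inj_eq (imset_inj _)).
exact: perm_inj.
Qed.

Lemma card_setD1 (a : 'I_n) y : a \in y -> #|y :\ a| = #|y|.-1.
Proof. by move=> ay; rewrite (cardsD1 a y) ay. Qed.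

Lemma imset_tperm_setD1 (a b : 'I_n) y : a \in y -> b \in y -> tperm a b @: (y :\ a) = y :\ b.
Proof.
move=> ay by_; apply/eqP; rewrite eqEcard card_imset; last exact: perm_inj.
apply/andP; split; last first.
  by rewrite !card_setD1.
apply/subsetP => i /imsetP [j]; rewrite !inE => /andP[ja jy ->].
case: tpermP ja => [->|->|/eqP h1 /eqP h2]; rewrite ?eqxx //.
  by move=> ab; rewrite eq_sym ab.
by rewrite h2.
Qed.

(** Such events cannot tell the coordinates of [y] apart, so the exit coordinate of a walk through
    [y] stays uniform given the event. Events about passing vertices above [y] qualify. *)
Definition tperm_invariant y (Z : pred 'S_n) :=
  forall (a b : 'I_n) s, a \in y -> b \in y -> Z (s * tperm a b)%g = Z s.

Lemma setD1_level_vertex s y : 0 < #|y| -> passes s y ->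
  exists2 e, e \in y & forall e', e' \in y -> passes s (y :\ e') = (e' == e).
Proof.
move=> y0 /passes_eq py.
have sub : level_vertex s #|y|.-1 \subset y.
  by rewrite {2}py; apply: level_vertex_subset; apply: leq_pred.
have cl : #|level_vertex s #|y|.-1| = #|y|.-1.
  by apply: card_level_vertex; apply: leq_trans (leq_pred _) (card_le_n y).
have /cards1P [e he] : #|y :\: level_vertex s #|y|.-1| == 1.
  by rewrite cardsD (setIidPr sub) cl; case: #|y| y0 => //= m _; rewrite subSnn.
have ee : e \in y by have := set11 e; rewrite -he inE => /andP[].
have hl : level_vertex s #|y|.-1 = y :\ e.
  by rewrite -he setDDr setDv set0U (setIidPr sub).
exists e => // e' e'y; rewrite /passes.
rewrite card_setD1 // hl; apply/eqP/eqP => [h|-> //].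
apply/eqP; apply: contraT => ne.
by have := setD11 e' y; rewrite -h !inE ne e'y.
Qed.

(* Right multiplication by [tperm e f] exchanges the walks that leave [y] through
   [e] and through [f]. *)
Lemma card_passes_setD1 y e (Z : pred 'S_n) : e \in y -> tperm_invariant y Z ->
  #|[set s | [&& passes s y, passes s (y :\ e) & Z s]]| * #|y| =
  #|[set s | passes s y & Z s]|.
Proof.
move=> ey inv; have y0 : 0 < #|y| by apply/card_gt0P; exists e.
have -> : #|[set s | passes s y & Z s]| =
   \sum_(e' in y) #|[set s | [&& passes s y, passes s (y :\ e') & Z s]]|.
  rewrite -sum1_card; under [in RHS]eq_bigr => i _ do rewrite -sum1_card.
  rewrite (exchange_big_dep (fun s => s \in [set s | passes s y & Z s])) /=; last first.
    by move=> i s _; rewrite !inE => /and3P[-> _ ->].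
  apply: eq_bigr => s; rewrite inE => /andP[py Zs].
  have [f fy hf] := setD1_level_vertex y0 py.
  rewrite (eq_bigl (pred1 f)) ?big_pred1_eq // => i /=.
  rewrite !inE py Zs andbT /=.
  case iy: (i \in y) => /=; first by rewrite hf.
  by apply/esym/eqP => h; rewrite h fy in iy.
rewrite mulnC -sum_nat_const; apply: eq_bigr => f fy.
rewrite -[LHS](card_imset _ (mulIg (tperm e f))); apply: eq_card => s.
apply/imsetP/idP => [[r]|].
  rewrite !inE => /and3P[py pe Zr] ->; rewrite passes_mul_tperm // py inv // Zr andbT /=.
  rewrite /passes /level_vertex walk_vertex_mulg.
  have -> : #|y :\ f| = #|y :\ e|.
    by rewrite !card_setD1.
  by rewrite -/(level_vertex r _) (eqP pe) imset_tperm_setD1.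
rewrite !inE => /and3P[py pe Zr]; exists (s * tperm e f)%g; last first.
  by rewrite -mulgA tperm2 mulg1.
rewrite inE passes_mul_tperm // py inv // Zr andbT /=.
rewrite /passes /level_vertex walk_vertex_mulg.
have -> : #|y :\ e| = #|y :\ f|.
  by rewrite !card_setD1.
by rewrite -/(level_vertex s _) (eqP pe) tpermC imset_tperm_setD1.
Qed.

Lemma passes_tperm_invariant y z : y \subset z -> tperm_invariant y (passes^~ z).
Proof. by move=> /subsetP yz a b s ay b_y; apply: passes_mul_tperm; apply: yz. Qed.

(** The upward counterpart of [setD1_level_vertex]: the vertex of level [#|y|.+1] is squeezed
    between [y] and [z]. *)
Lemma passes_between s y z : passes s y -> passes s z -> y \proper z ->
  exists2 e, e \in z :\: y & forall e', e' \in z :\: y -> passes s (e' |: y) = (e' == e).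
Proof.
move=> /passes_eq py /passes_eq pz yz.
have cyz : #|y| < #|z| by apply: proper_card.
have cl : #|level_vertex s #|y|.+1| = #|y|.+1.
  by apply: card_level_vertex; apply: leq_trans cyz (card_le_n z).
have yl : y \subset level_vertex s #|y|.+1 by rewrite {1}py; apply: level_vertex_subset.
have lz : level_vertex s #|y|.+1 \subset z by rewrite pz; apply: level_vertex_subset.
have /cards1P [e he] : #|level_vertex s #|y|.+1 :\: y| == 1.
  by rewrite cardsD (setIidPr yl) cl subSnn.
have [ny el] : e \notin y /\ e \in level_vertex s #|y|.+1.
  by have := set11 e; rewrite -he inE => /andP[].
exists e; first by rewrite inE ny (subsetP lz).
move=> e'; rewrite inE => /andP[ne' e'z]; rewrite /passes cardsU1 ne' add1n.
have -> : level_vertex s #|y|.+1 = e |: y.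
  apply/setP => i; move/setP: he => /(_ i); rewrite !inE => <-.
  case: (boolP (i \in y)) => /= iy; last by rewrite orbF.
  by have := subsetP yl _ iy; rewrite inE.
apply/eqP/eqP => [h|-> //].
by have := setU11 e' y; rewrite -h !inE (negbTE ne') orbF => /eqP.
Qed.

(** Induction on [#|z| - #|y|]. The walks are split by the vertex [e |: y] from which they enter
    [y]; by [card_passes_setD1] a fraction [1/(|y|+1)] of the walks through [e |: y] and [z] goes on
    to [y]. *)
Lemma card_passes_pair y z : y \subset z ->
  #|[set s | passes s y & passes s z]| * 'C(#|z|, #|y|) = #|[set s | passes s z]|.
Proof.
move: {2}(#|z| - #|y|) (erefl (#|z| - #|y|)) => d; elim: d y => [|d IH] y hd yz.
  have -> : y = z by apply/eqP; rewrite eqEcard yz /= -subn_eq0 hd.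
  by rewrite binn muln1; apply: eq_card => s; rewrite !inE andbb.
have lyz : #|y| < #|z| by rewrite -subn_gt0 hd.
have pyz : y \proper z by rewrite properEcard yz.
have H : #|[set s | passes s y & passes s z]| * #|y|.+1 =
   \sum_(e in z :\: y) #|[set s | passes s (e |: y) & passes s z]|.
  have -> : #|[set s | passes s y & passes s z]| =
     \sum_(e in z :\: y) #|[set s | [&& passes s (e |: y), passes s y & passes s z]]|.
    rewrite -sum1_card; under [in RHS]eq_bigr => i _ do rewrite -sum1_card.
    rewrite (exchange_big_dep (fun s => s \in [set s | passes s y & passes s z])) /=; last first.
      by move=> i s _; rewrite !inE => /and3P[_ -> ->].
    apply: eq_bigr => s; rewrite inE => /andP[py pz].
    have [f fy hf] := passes_between py pz pyz.
    rewrite (eq_bigl (pred1 f)) ?big_pred1_eq // => i /=.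
    have -> : (s \in [set s | [&& passes s (i |: y), passes s y & passes s z]]) = passes s (i |: y).
      by rewrite inE py pz !andbT.
    case iy: (i \in z :\: y) => /=; first by rewrite hf.
    by apply/esym/eqP => h; rewrite h fy in iy.
  rewrite big_distrl /=; apply: eq_bigr => e; rewrite inE => /andP[ey ez].
  have sub : e |: y \subset z by rewrite subUset sub1set ez.
  have := card_passes_setD1 (setU11 e y) (passes_tperm_invariant sub).
  by rewrite cardsU1 ey setU1K.
have H2 : #|[set s | passes s y & passes s z]| * #|y|.+1 * 'C(#|z|, #|y|.+1) =
   (#|z| - #|y|) * #|[set s | passes s z]|.
  rewrite H big_distrl /= -[in X in _ = X * _](setIidPr yz) -cardsD -sum_nat_const.
  apply: eq_bigr => e; rewrite inE => /andP[ey ez].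
  have cU : #|e |: y| = #|y|.+1 by rewrite cardsU1 ey.
  by have := IH (e |: y); rewrite cU subnS hd subUset sub1set ez; apply.
apply/eqP; rewrite -(eqn_pmul2l (m := #|z| - #|y|)) ?subn_gt0 //; apply/eqP.
by rewrite -H2 mulnCA -mul_bin_left mulnA.
Qed.

Lemma card_passes y : #|[set s | passes s y]| * 'C(n, #|y|) = n`!.
Proof.
have all s : passes s setT.
  rewrite /passes /level_vertex cardsT card_ord subnn; apply/eqP/setP => i; by rewrite !inE.
have := card_passes_pair (subsetT y); rewrite cardsT card_ord.
have -> : [set s | passes s setT] = setT by apply/setP => s; rewrite !inE all.
rewrite cardsT card_Sn => <-; congr (#|pred_of_set _| * _).
by apply/setP => s; rewrite !inE all andbT.
Qed.

End Walks.

(** * Expectation over sequences of independent uniform choices *)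

Section Expectation.
Local Open Scope ring_scope.
Variables (R : realType) (S : finType).
Hypothesis S_gt0 : (0 < #|S|)%N.
Implicit Types (f g : S -> R) (F G : seq S -> R).

Definition avg f : R := (\sum_s f s) / #|S|%:R.

Lemma le_avg f g : (forall s, f s <= g s) -> avg f <= avg g.
Proof. by move=> fg; rewrite ler_pM2r ?invr_gt0 ?ltr0n //; apply: ler_sum => s _. Qed.

Lemma avg_cst c : avg (fun=> c) = c.
Proof.
by rewrite /avg sumr_const -(mulr_natr c) mulfK // pnatr_eq0 -lt0n.
Qed.

Lemma avg_sum (I : Type) (r : seq I) (P : pred I) (f : I -> S -> R) :
  avg (fun s => \sum_(i <- r | P i) f i s) = \sum_(i <- r | P i) avg (f i).
Proof. by rewrite /avg exchange_big /= mulr_suml. Qed.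

Lemma avgZ c f : avg (fun s => c * f s) = c * avg f.
Proof. by rewrite /avg -mulr_sumr mulrA. Qed.

Lemma avgD f g : avg (fun s => f s + g s) = avg f + avg g.
Proof. by rewrite /avg big_split mulrDl. Qed.

Lemma avg_bool (P : pred S) : avg (fun s => (P s)%:R) = #|[set s | P s]|%:R / #|S|%:R.
Proof.
rewrite /avg -natr_sum -sum1dep_card [in RHS]big_mkcond /=; congr (_%:R / _).
Qed.

(** Walks are averaged one at a time, the first outermost, so that arguments can condition on a
    prefix. [expect_ffun] identifies this with the counting ratio over functions on ['I_T]. *)
Fixpoint expect (t : nat) F : R :=
  if t is t'.+1 then avg (fun s => expect t' (fun l => F (s :: l))) else F [::].

Lemma le_expect t F G : (forall l, size l = t -> F l <= G l) -> expect t F <= expect t G.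
Proof.
elim: t F G => [|t IH] F G h /=; first exact: h.
by apply: le_avg => s; apply: IH => l sl; apply: h; rewrite /= sl.
Qed.

Lemma eq_expect t F G : (forall l, size l = t -> F l = G l) -> expect t F = expect t G.
Proof.
by move=> h; apply/le_anti; rewrite !le_expect // => l /h ->.
Qed.

Lemma expect_cst t c : expect t (fun=> c) = c.
Proof.
elim: t => //= t IH; rewrite -[RHS]avg_cst /avg; congr (_ / _).
by apply: eq_bigr => s _; rewrite IH.
Qed.

Lemma expect_sum t (I : Type) (r : seq I) (P : pred I) (F : I -> seq S -> R) :
  expect t (fun l => \sum_(i <- r | P i) F i l) = \sum_(i <- r | P i) expect t (F i).
Proof.
elim: t F => //= t IH F; rewrite -avg_sum /avg; congr (_ / _).
by apply: eq_bigr => s _; rewrite IH.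
Qed.

Lemma expectD t F G : expect t (fun l => F l + G l) = expect t F + expect t G.
Proof.
elim: t F G => //= t IH F G; rewrite -avgD /avg; congr (_ / _).
by apply: eq_bigr => s _; rewrite IH.
Qed.

Lemma expectZ t c F : expect t (fun l => c * F l) = c * expect t F.
Proof.
elim: t F => //= t IH F; rewrite -avgZ /avg; congr (_ / _).
by apply: eq_bigr => s _; rewrite IH.
Qed.

(** Independence, in the form used by the Chernoff bound. *)
Lemma expect_prod t f : expect t (fun l => \prod_(s <- l) f s) = avg f ^+ t.
Proof.
elim: t => [|t IH] /=; first by rewrite big_nil.
rewrite exprS mulrC -avgZ /avg; congr (_ / _); apply: eq_bigr => s _.
by rewrite -IH mulrC -expectZ; apply: eq_expect => l _; rewrite big_cons.
Qed.

Lemma expect_cat t d F :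
  expect (t + d) F = expect t (fun l => expect d (fun l' => F (l ++ l'))).
Proof.
elim: t F => //= t IH F; rewrite /avg; congr (_ / _).
by apply: eq_bigr => s _; rewrite IH.
Qed.

(** Later walks average out, so each event can be evaluated at its own time inside the common
    horizon. *)
Lemma expect_take t T F : (t <= T)%N -> expect T (fun l => F (take t l)) = expect t F.
Proof.
move=> /subnKC <-; rewrite expect_cat; apply: eq_expect => l sl.
by rewrite -[RHS](expect_cst (T - t)); apply: eq_expect => l' _; rewrite take_size_cat.
Qed.

Lemma expect_tuple T F :
  expect T F = (\sum_(t : T.-tuple S) F t) / #|{: T.-tuple S}|%:R.
Proof.
elim: T F => [|T IH] F /=.
  rewrite card_tuple expn0 divr1 (bigD1 [tuple]) //= big1 ?addr0 // => t.
  by move/eqP; case; apply/val_inj; rewrite /= (tuple0 t).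
rewrite /avg (eq_bigr _ (fun s _ => IH (fun l => F (s :: l)))).
rewrite -mulr_suml !card_tuple expnSr natrM -mulrA -invfM; congr (_ / _).
rewrite pair_big /= (reindex (fun p : S * T.-tuple S => [tuple of p.1 :: p.2])) //=.
exists (fun t => (thead t, [tuple of behead t])) => /= [[s t] _|t _] /=.
  by congr pair; apply: val_inj.
by rewrite [RHS]tuple_eta; apply: val_inj.
Qed.

Lemma expect_ffun T (P : pred (seq S)) :
  #|[set w : {ffun 'I_T -> S} | P [seq w t | t <- enum 'I_T]]|%:R / #|{ffun 'I_T -> S}|%:R =
  expect T (fun l => (P l)%:R).
Proof.
rewrite expect_tuple card_ffun card_tuple card_ord; congr (_ / _).
rewrite -sum1dep_card natr_sum big_mkcond /=.
rewrite (reindex (fun t : T.-tuple S => [ffun i => tnth t i])) /=; last first.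
  exists (fun w : {ffun 'I_T -> S} => [tuple w i | i < T]) => [t _|w _].
    by apply: eq_from_tnth => i; rewrite tnth_mktuple ffunE.
  by apply/ffunP => i; rewrite ffunE tnth_mktuple.
apply: eq_bigr => t _.
have -> : [seq [ffun i => tnth t i] i | i <- enum 'I_T] = t.
  by rewrite -[RHS]map_tnth_enum; apply: eq_map => i; rewrite ffunE.
by case: (P t).
Qed.

End Expectation.

(** * The cluster *)

Section Cluster.
Variable n : nat.
Implicit Types (s : 'S_n) (y z : {set 'I_n}) (C : {set {set 'I_n}}) (l : seq 'S_n).

Definition cluster l : {set {set 'I_n}} := foldl (@dla_step n) (C0 n) l.

Lemma sub_dla_step C s : C \subset dla_step C s.
Proof. by rewrite /dla_step; case: ifP => // _; apply: subsetUr. Qed.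

Lemma sub_foldl_dla_step C l : C \subset foldl (@dla_step n) C l.
Proof.
elim: l C => //= s l IH C; exact: subset_trans (sub_dla_step C s) (IH _).
Qed.

Lemma sub_cluster_cat l l' : cluster l \subset cluster (l ++ l').
Proof. by rewrite /cluster foldl_cat sub_foldl_dla_step. Qed.

Lemma sub_cluster_take t l : cluster (take t l) \subset cluster l.
Proof. by rewrite -[X in _ \subset cluster X](cat_take_drop t) sub_cluster_cat. Qed.

Lemma set0_cluster l : set0 \in cluster l.
Proof. by apply: (subsetP (sub_foldl_dla_step _ l)); rewrite inE. Qed.

Lemma walk_vertex0 s : walk_vertex s 0 = setT.
Proof. by apply/setP => i; rewrite !inE. Qed.

Lemma walk_vertexn s : walk_vertex s n = set0.
Proof. by apply/setP => i; rewrite !inE leqNgt ltn_ord. Qed.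

Lemma dla_stepP C s : set0 \in C -> setT \notin C ->
  exists m, [/\ m < n, dla_step C s = walk_vertex s m |: C,
    walk_vertex s m.+1 \in C & forall j, j <= m -> walk_vertex s j \notin C].
Proof.
move=> C0' CT; rewrite /dla_step (negbTE CT).
cbv zeta; pose p j := walk_vertex s j \in C; rewrite -/p; set m := find p _.
have hp : has p (iota 0 n.+1).
  by apply/hasP; exists n; rewrite ?mem_iota ?add0n ?leq0n ?ltnSn //= /p walk_vertexn.
have mn : m < n.+1 by have := hp; rewrite has_find size_iota.
have pm : p m by have := nth_find 0 hp; rewrite nth_iota.
have lm j : j < m -> ~~ p j.
  move=> jm; have := before_find 0 jm.
  by rewrite nth_iota ?add0n ?(ltn_trans jm) // => ->.
(* Index 0 is excluded because the walk starts at the vacant vertex [setT]; hence the predecessor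
   taken in [dla_step] is not truncated. *)
clearbody m; case: m mn pm lm => [|m] mn pm lm.
  by move: pm; rewrite /p walk_vertex0 (negbTE CT).
exists m; split => //.
Qed.

(** The walk is vacant from the top down to [y] and occupied at [y :\ e], so the search in
    [dla_step] stops one step after [y]. *)
Lemma dla_step_adds C s y e : setT \notin C -> y \notin C -> passes s y ->
  e \in y -> y :\ e \in C -> passes s (y :\ e) ->
  (forall z, z \in C -> y \proper z -> ~~ passes s z) -> y \in dla_step C s.
Proof.
move=> CT yC py ey yeC pye av.
have cyn := card_le_n y.
have y0 : 0 < #|y| by apply/card_gt0P; exists e.
rewrite /dla_step (negbTE CT).
have -> : find (fun j => walk_vertex s j \in C) (iota 0 n.+1) = (n - #|y|).+1; last first.
  by rewrite /= -/(level_vertex s _) -(passes_eq py) setU11.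
pose p j := walk_vertex s j \in C; rewrite -/p.
have pj j : j <= n - #|y| -> ~~ p j.
  move=> jn; apply/negP => pj.
  have cj : #|walk_vertex s j| = n - j by rewrite card_walk_vertex.
  have sub : y \subset walk_vertex s j.
    by rewrite (passes_eq py); apply: walk_vertex_subset.
  have psj : passes s (walk_vertex s j).
    by rewrite /passes /level_vertex cj subKn //; lia.
  have [E|ne] := eqVneq (walk_vertex s j) y; first by rewrite /p E (negbTE yC) in pj.
  have pr : y \proper walk_vertex s j by rewrite properEneq eq_sym ne.
  by have := av _ pj pr; rewrite psj.
have pm : p (n - #|y|).+1.
  rewrite /p; move: (passes_eq pye); rewrite /level_vertex card_setD1 //.
  have -> : n - #|y|.-1 = (n - #|y|).+1 by lia.
  by move=> <-.
have hp : has p (iota 0 n.+1).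
  by apply/hasP; exists (n - #|y|).+1 => //; rewrite mem_iota; lia.
have lt := hp; rewrite has_find size_iota in lt.
have pf : p (find p (iota 0 n.+1)) by have := nth_find 0 hp; rewrite nth_iota.
apply/eqP; rewrite eqn_leq; apply/andP; split; last first.
  by rewrite ltnNge; apply/negP => /pj; rewrite pf.
rewrite leqNgt; apply/negP => h; have := before_find 0 h.
by rewrite nth_iota ?add0n ?pm //; lia.
Qed.

(* A vertex above level [a] sticks to an occupied vertex of level [a], which an
   earlier walk has visited. *)
Lemma card_cluster_le a l z : 0 < a <= n -> uniq [seq level_vertex s a | s <- l] ->
  z \in cluster l -> #|z| <= a.
Proof.
move=> /andP[a0 an].
(* The induction also carries that occupied vertices of level exactly [a] were visited by walks of
   [l]. *)
suff H : uniq [seq level_vertex s a | s <- l] -> forall z, z \in cluster l ->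
    #|z| <= a /\ (#|z| = a -> z \in [seq level_vertex s a | s <- l]).
  by move=> /H h /h [].
elim/last_ind: l {z} => [_ z|l s IH].
  by rewrite inE => /eqP ->; rewrite cards0; split => // h; rewrite -h in a0.
rewrite map_rcons rcons_uniq => /andP[nin /IH {}IH] z.
rewrite /cluster foldl_rcons -/(cluster l) mem_rcons inE.
have [CT|CT] := boolP (setT \in cluster l).
  rewrite /dla_step CT => /IH [-> h]; split => // /h ->; by rewrite orbT.
have [m [mn -> vC _]] := dla_stepP s (set0_cluster l) CT.
rewrite in_setU1 => /orP[/eqP ->|/IH [-> h]]; last by split => // /h ->; rewrite orbT.
have [le h] := IH _ vC; rewrite !card_walk_vertex in le h *.
have le2 : n - m <= a.
  rewrite leqNgt; apply/negP => lt; have E : n - m.+1 = a by lia.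
  have E2 : walk_vertex s m.+1 = level_vertex s a by rewrite /level_vertex; congr walk_vertex; lia.
  by rewrite -E2 h in nin.
split => // E; apply/orP; left; apply/eqP; rewrite /level_vertex; congr walk_vertex; lia.
Qed.

End Cluster.

(** * The growth of the cluster at a fixed level *)

(** Trinomial revision. It factors the pair probability [1/(C(n,j) C(j,k))] as [1/C(n,k)] times the
    conditional probability [1/C(n-k,j-k)] that [blocking] sums. *)
Lemma mul_bin_bin n j k : k <= j <= n ->
  'C(n, j) * 'C(j, k) = 'C(n, k) * 'C(n - k, j - k).
Proof.
move=> /andP[kj jn].
have f0 m : 0 < m`! by apply: fact_gt0.
have := bin_fact jn; have := bin_fact kj; have := bin_fact (leq_trans kj jn).
have := @bin_fact (n - k) (j - k); rewrite leq_sub2r // => /(_ isT).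
have -> : n - k - (j - k) = n - j by lia.
move=> e1 e2 e3 e4.
apply/eqP; rewrite -(eqn_pmul2r (m := k`! * (j - k)`! * (n - j)`!)) ?muln_gt0 ?f0 //.
apply/eqP; transitivity n`!; first by rewrite -e4 -e3; ring.
by rewrite -e2 -e1; ring.
Qed.

Section Growth.
Local Open Scope ring_scope.
Variables (R : realType) (n : nat).
Implicit Types (s : 'S_n) (y z : {set 'I_n}) (C S : {set {set 'I_n}}) (l : seq 'S_n).

Definition blocking y C : R :=
  \sum_(z in C | y \proper z) ('C(n - #|y|, #|z| - #|y|)%:R)^-1.

Definition half_supported y C := (#|y| <= 2 * #|[set e in y | y :\ e \in C]|)%N.

Definition unobstructed y C s := [forall z in C, (y \proper z) ==> ~~ passes s z].

Lemma card_perm_gt0 : (0 < #|'S_n|)%N.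
Proof. by rewrite card_Sn fact_gt0. Qed.

Lemma prob_passes y : avg (fun s => (passes s y)%:R) = ('C(n, #|y|)%:R)^-1 :> R.
Proof.
have b0 : ('C(n, #|y|)%:R : R) != 0 by rewrite pnatr_eq0 -lt0n bin_gt0 card_le_n.
have f0 : (#|'S_n|%:R : R) != 0 by rewrite pnatr_eq0 -lt0n card_perm_gt0.
rewrite avg_bool; apply: (mulfI b0); rewrite divff // mulrA -natrM mulnC card_passes.
by rewrite -card_Sn divff.
Qed.

Lemma prob_passes_pair y z : y \subset z ->
  avg (fun s => (passes s y && passes s z)%:R) =
  ('C(n, #|z|)%:R)^-1 * ('C(#|z|, #|y|)%:R)^-1 :> R.
Proof.
move=> yz; rewrite -prob_passes !avg_bool -(card_passes_pair yz) natrM.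
have b0 : ('C(#|z|, #|y|)%:R : R) != 0 by rewrite pnatr_eq0 -lt0n bin_gt0 subset_leq_card.
by rewrite mulrAC mulfK.
Qed.

(** Whether a walk is stopped above [y] is settled before it leaves [y], which keeps its exit
    coordinate uniform. *)
Lemma unobstructed_invariant y C : tperm_invariant y (unobstructed y C).
Proof.
move=> a b s ay b_y; apply: eq_forallb => z.
case: (boolP (y \proper z)) => //= yz.
by rewrite passes_mul_tperm //; apply: (subsetP (proper_sub yz)).
Qed.

(** Union bound over the occupied [z] above [y]. *)
Lemma prob_unobstructed y C :
  ('C(n, #|y|)%:R)^-1 * (1 - blocking y C) <=
  avg (fun s => (passes s y && unobstructed y C s)%:R) :> R.
Proof.
rewrite mulrBr mulr1 /blocking mulr_sumr.
rewrite -prob_passes lerBlDr.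
have E z : y \proper z -> ('C(n, #|y|)%:R)^-1 * ('C(n - #|y|, #|z| - #|y|)%:R)^-1 =
   avg (fun s => (passes s y && passes s z)%:R) :> R.
  move=> /proper_sub yz; rewrite prob_passes_pair // -!invfM -!natrM.
  by rewrite mul_bin_bin // card_le_n subset_leq_card.
have -> : \sum_(z in C | y \proper z) avg (fun s => (passes s y)%:R) *
     ('C(n - #|y|, #|z| - #|y|)%:R)^-1 =
   avg (fun s => \sum_(z in C | y \proper z) (passes s y && passes s z)%:R) :> R.
  rewrite avg_sum; apply: eq_bigr => z /andP[_ yz].
  by rewrite -E // prob_passes.
rewrite -avgD.
apply: le_avg; first exact: card_perm_gt0.
move=> s; case py: (passes s y) => /=; last by rewrite add0r big1.
case un: (unobstructed y C s) => /=; first by rewrite lerDl; apply: sumr_ge0 => z _; case: passes.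
move/negbT: un => /forallPn[z] /=; rewrite 2!negb_imply negbK => /and3P[zC yz pz].
rewrite add0r (bigD1 z) /= ?zC //= pz lerDl; apply: sumr_ge0 => z' _; by case: passes.
Qed.

(* Takes only the values 0 and 1: at most one summand is nonzero. *)
Definition sticks y C s : nat :=
  \sum_(e in y | y :\ e \in C) (passes s y && passes s (y :\ e) && unobstructed y C s).

(** An unobstructed passage through [y] has probability at least [1/(2 C(n,|y|))], and its uniform
    exit coordinate leads to an occupied vertex at least half of the time. *)
Lemma prob_sticks y C : (0 < #|y|)%N -> half_supported y C -> blocking y C <= 2^-1 ->
  ((4 * 'C(n, #|y|))%:R)^-1 <= avg (fun s => (sticks y C s)%:R) :> R.
Proof.
move=> y0 hs bl.
have y0' : (#|y|%:R : R) != 0 by rewrite pnatr_eq0 -lt0n.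
have P := prob_unobstructed y C.
set Q := avg _ in P.
have E e : e \in y ->
   avg (fun s => (passes s y && passes s (y :\ e) && unobstructed y C s)%:R) = Q / #|y|%:R.
  move=> ey; rewrite /Q !avg_bool -(card_passes_setD1 ey (unobstructed_invariant C)).
  rewrite natrM mulrAC mulfK //; congr (_%:R / _); apply: eq_card => s.
  by rewrite !inE andbA.
have -> : avg (fun s => (sticks y C s)%:R) =
    \sum_(e in y | y :\ e \in C) (Q / #|y|%:R) :> R.
  transitivity (avg (fun s => \sum_(e in y | y :\ e \in C)
     (passes s y && passes s (y :\ e) && unobstructed y C s)%:R) : R).
    by rewrite /avg; congr (_ / _); apply: eq_bigr => s _; rewrite /sticks natr_sum.
  rewrite (avg_sum _ (fun e => (e \in y) && (y :\ e \in C))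
    (fun e s => (passes s y && passes s (y :\ e) && unobstructed y C s)%:R)).
  by apply: eq_bigr => e /andP[/E].
rewrite sumr_const -[X in _ <= X]mulr_natr.
have b0 : (0 : R) < 'C(n, #|y|)%:R by rewrite ltr0n bin_gt0 card_le_n.
have Q2 : ('C(n, #|y|)%:R)^-1 / 2 <= Q.
  apply: le_trans P; rewrite ler_pM2l ?invr_gt0 //; lra.
have hs' : #|y|%:R <= 2 * #|[set e in y | y :\ e \in C]|%:R :> R by rewrite -natrM ler_nat.
rewrite cardsE in hs'.
have yp : (0 : R) < #|y|%:R by rewrite ltr0n.
rewrite natrM invfM mulrAC ler_pdivlMr //.
set c := (_ ^-1) in Q2 *.
have c0 : 0 < c by rewrite invr_gt0.
move: hs'; set N := (X in _ <= 2 * X -> _) => hs'.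
apply: le_trans (_ : c / 2 * N <= _).
  have -> : 4^-1 * c * #|y|%:R = c / 4 * #|y|%:R by ring.
  have -> : c / 2 * N = c / 4 * (2 * N) by field.
  by rewrite ler_pM2l ?divr_gt0.
by rewrite ler_wpM2r // ler0n.
Qed.

Lemma sticks_le y C s : (sticks y C s <= passes s y)%N.
Proof.
rewrite /sticks; case py: (passes s y) => /=; last by rewrite big1.
have [y0|] := posnP #|y|; first by rewrite big1 // => e; rewrite (cards0_eq y0) inE.
move=> y0; have [e ey he] := setD1_level_vertex y0 py.
apply: leq_trans (_ : \sum_(e' in y) (e' == e) <= _)%N; last first.
  by rewrite (bigD1 e) //= eqxx big1 // => i /andP[_ /negbTE ->].
rewrite big_mkcondr; apply: leq_sum => i iy; rewrite he //.
by case: ifP => // _; case: (i == e) => //=; apply: leq_b1.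
Qed.

Lemma sticks_dla_step y C s : setT \notin C -> y \notin C -> (0 < sticks y C s)%N ->
  y \in dla_step C s.
Proof.
move=> CT yC; rewrite lt0n sum_nat_eq0 negb_forall => /existsP [e].
rewrite negb_imply => /andP[/andP[ey yeC]]; rewrite eqb0 negbK => /andP[/andP[py pe] un].
apply: (dla_step_adds CT yC py ey yeC pe) => z zC yz.
by move/forallP: un => /(_ z) /implyP /(_ zC) /implyP /(_ yz).
Qed.

(** The top vertex alone would contribute 1, so small blocking also certifies that the process is
    still running. *)
Lemma blocking_setT y C : y \notin C -> blocking y C <= 2^-1 -> setT \notin C.
Proof.
move=> yC bl; apply/negP => TC; have : 1 <= blocking y C; last by lra.
have yT : y \proper setT by rewrite properT; apply: contraNneq yC => ->.
rewrite /blocking (bigD1 setT) ?TC //= cardsT card_ord binn invr1 lerDl.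
by apply: sumr_ge0 => z _; rewrite invr_ge0 ler0n.
Qed.

(** A walk meets level [k] only once, so the sticking events of different vertices of [S] exclude
    each other and their probabilities add up. *)
Lemma prob_avoid_step S C k : (0 < k)%N ->
  (forall y, y \in S -> [/\ #|y| = k, half_supported y C & blocking y C <= 2^-1]) ->
  [disjoint S & C] ->
  avg (fun s => [disjoint S & dla_step C s]%:R) <= 1 - #|S|%:R / (4 * 'C(n, k))%:R :> R.
Proof.
move=> k0 hS dis.
apply: le_trans (_ : 1 - avg (fun s => \sum_(y in S) (sticks y C s)%:R) <= _); last first.
  rewrite lerD2l lerN2 (avg_sum _ (fun y => y \in S) (fun y s => (sticks y C s)%:R)).
  rewrite mulrC mulr_natr -sumr_const; apply: ler_sum => y /hS [yk h b].
  by rewrite -yk; apply: prob_sticks; rewrite // yk.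
rewrite lerBrDr -avgD -[X in _ <= X](avg_cst card_perm_gt0).
apply: le_avg; first exact: card_perm_gt0.
move=> s; rewrite -natr_sum -natrD lern1.
have [->|] := posnP (\sum_(y in S) sticks y C s)%N; first by rewrite addn0 leq_b1.
rewrite lt0n sum_nat_eq0 negb_forall => /existsP [y]; rewrite negb_imply -lt0n => /andP[yS st].
have [yk _ bl] := hS _ yS.
have yC : y \notin C by rewrite (disjointFr dis yS).
have -> : [disjoint S & dla_step C s] = false.
  by apply/negbTE/pred0Pn; exists y; rewrite /= yS sticks_dla_step // (blocking_setT yC).
have py : passes s y by have := leq_trans st (sticks_le y C s); case: passes.
rewrite add0n (bigD1 y) //= big1 ?addn0.
  by apply: leq_trans (sticks_le y C s) (leq_b1 _).
move=> z /andP[zS zy]; apply/eqP; rewrite -leqn0; apply: leq_trans (sticks_le z C s) _.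
rewrite leqn0 eqb0; apply: contra zy => /passes_eq ->; have [-> _ _] := hS _ zS.
by rewrite [X in _ == X](passes_eq py) yk.
Qed.

Lemma sub_half_supported y C C' : C \subset C' -> half_supported y C -> half_supported y C'.
Proof.
move=> CC' h; apply: leq_trans h _; rewrite leq_mul2l /=; apply: subset_leq_card.
by apply/subsetP => e; rewrite !inE => /andP[-> /(subsetP CC')].
Qed.

Lemma sub_blocking y C C' : C \subset C' -> blocking y C <= blocking y C'.
Proof.
move=> CC'; rewrite /blocking !big_mkcondr /= [X in _ <= X](big_setID C) /= (setIidPr CC').
by rewrite lerDl; apply: sumr_ge0 => z _; case: ifP => // _; rewrite invr_ge0 ler0n.
Qed.

(** Blocking grows with the cluster, so a bound on it at the end holds at every earlier step; half
    support, once present, is never lost. Hence [prob_avoid_step] applies to each of the [d] walks,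
    with [1 - q <= exp(-q)]. *)
Lemma prob_avoid S C k d : (0 < k)%N ->
  (forall y, y \in S -> #|y| = k /\ half_supported y C) ->
  expect d (fun l => let C' := foldl (@dla_step n) C l in
     ([disjoint S & C'] && [forall y in S, blocking y C' <= 2^-1])%:R)
  <= expR (- (#|S|%:R / (4 * 'C(n, k))%:R)) ^+ d :> R.
Proof.
move=> k0; elim: d C => [|d IH] C hS /=; first by rewrite expr0 lern1 leq_b1.
set q := _ / _ in IH *.
have [/andP[dis /forallP bl]|nG] := boolP ([disjoint S & C] && [forall y in S, blocking y C <= 2^-1]).
  rewrite exprS mulrC.
  apply: le_trans (_ : avg (fun s => expR (- q) ^+ d * [disjoint S & dla_step C s]%:R) <= _).
    apply: le_avg; first exact: card_perm_gt0.
    move=> s; have [dis'|nd] := boolP [disjoint S & dla_step C s].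
      rewrite mulr1; apply: IH => y /hS [yk h]; split => //.
      exact: sub_half_supported (sub_dla_step C s) h.
    rewrite mulr0 -[X in _ <= X](expect_cst card_perm_gt0 d); apply: le_expect.
      exact: card_perm_gt0.
    move=> l _ /=; rewrite lern0 eqb0 negb_and; apply/orP; left.
    apply: contra nd; apply: disjointWr.
    exact: sub_foldl_dla_step.
  rewrite avgZ ler_wpM2l ?exprn_ge0 ?expR_ge0 //.
  apply: le_trans (expR_ge1Dx _); apply: prob_avoid_step => // y yS.
  by have [-> h] := hS _ yS; split => //; move/implyP: (bl y); apply.
(* Otherwise the event already fails for [C] and, by monotonicity, for every later cluster. *)
apply: le_trans (_ : 0 <= _); last by rewrite exprn_ge0 ?expR_ge0.
rewrite -[X in _ <= X](expect_cst card_perm_gt0 d.+1) /=; apply: le_avg.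
  exact: card_perm_gt0.
move=> s; apply: le_expect; first exact: card_perm_gt0.
move=> l _; rewrite lern0 eqb0; apply: contra nG => /andP[dis /forallP bl].
have sub := subset_trans (sub_dla_step C s) (sub_foldl_dla_step _ l).
apply/andP; split; first by apply: disjointWr dis.
apply/forallP => y; apply/implyP => yS; apply: le_trans (sub_blocking _ sub) _.
by move/implyP: (bl y); apply.
Qed.

End Growth.

(** * Bounding the obstruction from above *)

(** The ratio of the two binomials is [(m-i)/(i+1)], at least 2 here. Sums of reciprocal binomials
    are thus dominated by geometric series. *)
Lemma bin_double m i : 3 * i + 2 <= m -> 2 * 'C(m, i) <= 'C(m, i.+1).
Proof.
move=> h; rewrite -(leq_pmul2l (ltn0Sn i)) mul_bin_left mulnCA mulnA.
by apply: leq_mul => //; lia.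
Qed.

Section Exposure.
Local Open Scope ring_scope.
Variables (R : realType) (n : nat).
Implicit Types (s : 'S_n) (y z : {set 'I_n}) (C S : {set {set 'I_n}}) (l : seq 'S_n).

Lemma sum_inv_double (c : nat -> nat) p q :
  (0 < c p)%N -> (forall j, p <= j -> j.+1 < q -> 2 * c j <= c j.+1)%N ->
  \sum_(p <= j < q) ((c j)%:R)^-1 <= 2 / (c p)%:R :> R.
Proof.
have [d] := ubnP (q - p)%N; elim: d p => // d IH p hd c0 h.
have cp : (0 : R) < (c p)%:R by rewrite ltr0n.
have [qp|pq] := leqP q p; first by rewrite big_geq // divr_ge0 // ler0n.
have [qp|pq1] := leqP q p.+1.
  have -> : q = p.+1 by lia.
  by rewrite big_nat1 ler_peMl ?invr_ge0 ?ler0n // ler1n.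
have h2 := h p (leqnn p) pq1.
rewrite big_ltn //.
have := IH p.+1; rewrite subnS; move=> /(_ _ _ _) IH'.
have {IH'} : \sum_(p.+1 <= j < q) ((c j)%:R)^-1 <= 2 / (c p.+1)%:R :> R.
  by apply: IH' => [||j hj]; [lia | lia | apply: h; lia].
have : 2 / (c p.+1)%:R <= (c p)%:R^-1 :> R.
  rewrite ler_pdivrMr ?ltr0n; last by lia.
  by rewrite mulrC ler_pdivlMr // -natrM ler_nat.
set A := \sum_(_ <= _ < _) _; set B := _ / _; set D := _ ^-1; lra.
Qed.

(** What the walk could add to [blocking] at all its vertices above [y] up to level [a], wherever it
    really stops. Without reference to the cluster, the exposures of different walks are
    independent. *)
Definition exposure a y s : R :=
  \sum_(#|y|.+1 <= j < a.+1 | y \subset level_vertex s j) ('C(n - #|y|, j - #|y|)%:R)^-1.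

Lemma exposure_le a y s : (3 * a <= n - #|y|)%N -> (#|y| < n)%N ->
  exposure a y s <= 2 / (n - #|y|)%:R.
Proof.
move=> ha hy; apply: le_trans (_ : \sum_(#|y|.+1 <= j < a.+1) ('C(n - #|y|, j - #|y|)%:R)^-1 <= _).
  rewrite /exposure big_mkcond; apply: ler_sum => j _; case: ifP => // _.
  by rewrite invr_ge0 ler0n.
have E : 'C(n - #|y|, #|y|.+1 - #|y|) = (n - #|y|)%N by rewrite subSnn bin1.
rewrite -[X in _ <= _ / X%:R]E.
apply: (sum_inv_double (c := fun j => 'C(n - #|y|, j - #|y|))).
  by rewrite E subn_gt0.
move=> j yj ja; rewrite subSn; last exact: ltnW.
by apply: bin_double; lia.
Qed.

(** Sum over the vertices [z] of level [j] above [y]: a walk through [y] meets exactly one of them,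
    and passing both has the probability of passing [z] divided by [C(j,|y|)]. *)
Lemma prob_subset_level_vertex y j : (#|y| <= j <= n)%N ->
  avg (fun s => (y \subset level_vertex s j)%:R) = 'C(j, #|y|)%:R / 'C(n, #|y|)%:R :> R.
Proof.
move=> /andP[yj jn].
have E s : (y \subset level_vertex s j)%:R =
    \sum_(z : {set 'I_n} | (y \subset z) && (#|z| == j)) (passes s z)%:R :> R.
  have p0 : passes s (level_vertex s j) by apply: passes_level_vertex.
  have c0 : #|level_vertex s j| = j by apply: card_level_vertex.
  have H z : #|z| = j -> passes s z -> z = level_vertex s j.
    by move=> zj /passes_eq ->; rewrite zj.
  case: (boolP (y \subset _)) => [sub|nsub].
    rewrite (bigD1 (level_vertex s j)) ?sub ?c0 //= p0 big1 ?addr0 // => z.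
    move=> /andP[/andP[_ /eqP zj] ne].
    by case: (boolP (passes s z)) => // /(H _ zj) E; rewrite E eqxx in ne.
  rewrite big1 // => z /andP[yz /eqP zj].
  by case: (boolP (passes s z)) => // /(H _ zj) E; rewrite E (negbTE nsub) in yz.
have E2 s : (passes s y)%:R =
    \sum_(z : {set 'I_n} | (y \subset z) && (#|z| == j)) (passes s y && passes s z)%:R :> R.
  case: (boolP (passes s y)) => py /=; last by rewrite big1.
  rewrite -E; suff -> : y \subset level_vertex s j by [].
  by rewrite {1}(passes_eq py); apply: level_vertex_subset.
rewrite -prob_passes.
have -> : avg (fun s => (passes s y)%:R) = avg (fun s =>
    \sum_(z : {set 'I_n} | (y \subset z) && (#|z| == j)) (passes s y && passes s z)%:R) :> R.
  by rewrite /avg (eq_bigr _ (fun s _ => E2 s)).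
have -> : avg (fun s => (y \subset level_vertex s j)%:R) = avg (fun s =>
    \sum_(z : {set 'I_n} | (y \subset z) && (#|z| == j)) (passes s z)%:R) :> R.
  by rewrite /avg (eq_bigr _ (fun s _ => E s)).
rewrite !avg_sum mulr_sumr; apply: eq_bigr => z /andP[yz /eqP zj].
rewrite prob_passes prob_passes_pair // zj mulrCA mulfV ?mulr1 //.
by rewrite pnatr_eq0 -lt0n bin_gt0.
Qed.

(** Trinomial revision: the weight [1/C(n-|y|,j-|y|)] times the probability [C(j,|y|)/C(n,|y|)] is
    [1/C(n,j)]. *)
Lemma mean_exposure a y : (a <= n)%N ->
  avg (exposure a y) = \sum_(#|y|.+1 <= j < a.+1) ('C(n, j)%:R)^-1.
Proof.
move=> an; rewrite /exposure.
have -> : avg (fun s => \sum_(#|y|.+1 <= j < a.+1 | y \subset level_vertex s j)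
      ('C(n - #|y|, j - #|y|)%:R)^-1) =
   avg (fun s => \sum_(#|y|.+1 <= j < a.+1)
      ('C(n - #|y|, j - #|y|)%:R)^-1 * (y \subset level_vertex s j)%:R) :> R.
  rewrite /avg; congr (_ / _); apply: eq_bigr => s _; rewrite big_mkcond /=.
  by apply: eq_bigr => j _; case: (y \subset _); rewrite ?mulr1 ?mulr0.
rewrite avg_sum; apply: eq_big_nat => j /andP[yj ja].
have jn : (#|y| <= j <= n)%N by lia.
rewrite avgZ prob_subset_level_vertex //.
have b1 : ('C(n, #|y|)%:R : R) != 0 by rewrite pnatr_eq0 -lt0n bin_gt0 card_le_n.
have b2 : ('C(n, j)%:R : R) != 0 by rewrite pnatr_eq0 -lt0n bin_gt0; lia.
have b3 : ('C(n - #|y|, j - #|y|)%:R : R) != 0 by rewrite pnatr_eq0 -lt0n bin_gt0; lia.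
have E : 'C(n, j)%:R * 'C(j, #|y|)%:R = 'C(n, #|y|)%:R * 'C(n - #|y|, j - #|y|)%:R :> R.
  by rewrite -!natrM mul_bin_bin.
apply: (mulfI b2); rewrite divff //.
transitivity ('C(n, j)%:R * 'C(j, #|y|)%:R / ('C(n, #|y|)%:R * 'C(n - #|y|, j - #|y|)%:R) : R).
  by field; rewrite b1 b3.
by rewrite E divff // mulf_neq0.
Qed.

(** Each walk adds at most one vertex. If it lies above [y], it is the walk's own vertex at some
    level from [|y|+1] to [a], so its weight is a term of the exposure. *)
Lemma blocking_cluster_le a y l : (forall z, z \in cluster l -> #|z| <= a)%N ->
  blocking R y (cluster l) <= \sum_(s <- l) exposure a y s.
Proof.
elim/last_ind: l => [|l s IH] h.
  rewrite big_nil /blocking big1 // => z /andP[]; rewrite inE => /eqP -> .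
  by rewrite /proper sub0set andbF.
have e0 : 0 <= exposure a y s by apply: sumr_ge0 => j _; rewrite invr_ge0 ler0n.
have hl : forall z, z \in cluster l -> (#|z| <= a)%N.
  by move=> z zl; apply: h; rewrite -cats1; apply: subsetP zl; apply: sub_cluster_cat.
move: h; rewrite -[in X in _ <= X]cats1 big_cat big_seq1 /= /cluster foldl_rcons -/(cluster l).
have [CT|CT] := boolP (setT \in cluster l).
  by rewrite /dla_step CT => _; apply: le_trans (IH hl) _; rewrite lerDl.
have [m [mn -> _ nC]] := dla_stepP s (set0_cluster l) CT => h.
rewrite /blocking big_mkcondr big_setU1 /=; last exact: nC.
rewrite -big_mkcondr -/(blocking R y (cluster l)) addrC.
apply: lerD; first exact: IH.
case: ifP => // yv; set v := walk_vertex s m in yv *.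
have va : (#|v| <= a)%N by apply: h; apply: setU11.
have pv : v = level_vertex s #|v|.
  by rewrite /level_vertex card_walk_vertex subKn // ltnW.
have yv' := proper_card yv.
rewrite /exposure big_mkcond /= (bigD1_seq #|v|) ?mem_index_iota ?iota_uniq /= ?yv' //.
rewrite -pv (proper_sub yv) lerDl; apply: sumr_ge0 => j _.
by case: ifP => // _; rewrite invr_ge0 ler0n.
Qed.

Lemma expR_le1D2x (x : R) : 0 <= x <= 2^-1 -> expR x <= 1 + 2 * x.
Proof.
move=> /andP[x0 x2]; have := expR_ge1Dx (- x); rewrite expRN => h.
have e0 := expR_gt0 x.
have h2 : (1 - x) * expR x <= 1 by rewrite -ler_pdivlMr // div1r.
have : 1 <= (1 - x) * (1 + 2 * x) by nra.
move=> h3; have x1 : 0 < 1 - x by lra.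
by rewrite -(ler_pM2l x1); apply: le_trans h2 h3.
Qed.

(** Chernoff bound. The total mean is at most [2t/C(n,|y|+1) <= 1/8], well below the threshold 1/2;
    the exponent is [-lam/2 + 4 lam/16 = -lam/4]. *)
Lemma prob_exposure_gt a y t : (10 * a <= n)%N -> (#|y| < a)%N -> (16 * t <= 'C(n, #|y|.+1))%N ->
  expect t (fun l => (2^-1 < \sum_(s <- l) exposure a y s)%R%:R) <=
  expR (- ((n - #|y|)%:R / 16)) :> R.
Proof.
(* As [exposure] is at most [2/(n-|y|)], this choice keeps [lam] times it within 1/2, the range of
   [expR_le1D2x]. *)
move=> ha hy ht; pose lam : R := (n - #|y|)%:R / 4.
have m0 : (0 : R) < (n - #|y|)%:R by rewrite ltr0n subn_gt0; lia.
have lam0 : 0 < lam by rewrite divr_gt0.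
apply: le_trans (_ : expect t (fun l =>
    expR (- (lam / 2)) * \prod_(s <- l) expR (lam * exposure a y s)) <= _).
  apply: le_expect; first exact: card_perm_gt0.
  move=> l _; rewrite -expR_sum -mulr_sumr -expRD.
  case: (boolP (2^-1 < _)) => [lt|_]; last exact: expR_ge0.
  rewrite -[X in X <= _]expR0 ler_expR.
  have := ler_wpM2l (ltW lam0) (ltW lt); lra.
rewrite expectZ expect_prod; last exact: card_perm_gt0.
have b0 : (0 : R) < 'C(n, #|y|.+1)%:R by rewrite ltr0n bin_gt0; lia.
have mean : avg (exposure a y) <= 2 / 'C(n, #|y|.+1)%:R.
  rewrite mean_exposure; last by lia.
  apply: (sum_inv_double (c := fun j => 'C(n, j))); first by rewrite bin_gt0; lia.
  by move=> j h1 h2; apply: bin_double; lia.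
have mgf : avg (fun s => expR (lam * exposure a y s)) <= expR (4 * lam / 'C(n, #|y|.+1)%:R).
  apply: le_trans (_ : 1 + (2 * lam) * avg (exposure a y) <= _); last first.
    apply: le_trans (expR_ge1Dx _); rewrite lerD2l.
    have -> : 4 * lam / 'C(n, #|y|.+1)%:R = 2 * lam * (2 / 'C(n, #|y|.+1)%:R).
      by field; rewrite gt_eqF.
    by rewrite ler_pM2l // mulr_gt0.
  rewrite -avgZ -[X in X + _](avg_cst (card_perm_gt0 n)) -avgD.
  apply: le_avg; first exact: card_perm_gt0.
  move=> s; rewrite -mulrA; apply: expR_le1D2x; apply/andP; split.
    by apply: mulr_ge0; [exact: ltW | apply: sumr_ge0 => j _; rewrite invr_ge0 ler0n].
  have : exposure a y s <= 2 / (n - #|y|)%:R by apply: exposure_le; lia.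
  move=> /(ler_wpM2l (ltW lam0)) /le_trans; apply.
  rewrite /lam; set m := _%:R in m0 *.
  have -> : m / 4 * (2 / m) = 2^-1 by field; rewrite gt_eqF.
  by [].
apply: le_trans (_ : expR (- (lam / 2)) * expR (4 * lam / 'C(n, #|y|.+1)%:R) ^+ t <= _).
  rewrite ler_pM2l ?expR_gt0 //; apply: lerXn2r => //; rewrite nnegrE ?expR_ge0 //.
  rewrite -(avg_cst (card_perm_gt0 n) 0); apply: le_avg; first exact: card_perm_gt0.
  by move=> s; apply: expR_ge0.
rewrite -expRM_natr -expRD ler_expR.
have tb : t%:R / 'C(n, #|y|.+1)%:R <= 16^-1 :> R.
  by rewrite ler_pdivrMr // mulrC ler_pdivlMr // -natrM ler_nat mulnC.
have -> : 4 * lam / 'C(n, #|y|.+1)%:R * t%:R = 4 * lam * (t%:R / 'C(n, #|y|.+1)%:R).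
  by field; rewrite gt_eqF.
have l4 : 0 <= 4 * lam by rewrite mulr_ge0 // ltW.
have := ler_wpM2l l4 tb; rewrite /lam; lra.
Qed.

(** Birthday bound, one walk at a time: the next walk meets the level-[a] vertex of a given earlier
    walk with probability [1/C(n,a)]. *)
Lemma prob_collision a t : (a <= n)%N ->
  expect t (fun l => (~~ uniq [seq level_vertex s a | s <- l])%:R) <=
  t%:R ^+ 2 / 'C(n, a)%:R :> R.
Proof.
move=> an; have b0 : (0 : R) < 'C(n, a)%:R by rewrite ltr0n bin_gt0.
elim: t => [|t IH]; first by rewrite /= expr0n mul0r.
rewrite -addn1 expect_cat.
apply: le_trans (_ : expect t (fun l =>
    (~~ uniq [seq level_vertex s a | s <- l])%:R + t%:R / 'C(n, a)%:R) <= _).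
  apply: le_expect; first exact: card_perm_gt0.
  move=> l sl /=.
  apply: le_trans (_ : avg (fun s => (~~ uniq [seq level_vertex s a | s <- l])%:R +
       \sum_(r <- l) (passes s (level_vertex r a))%:R) <= _).
    apply: le_avg; first exact: card_perm_gt0.
    move=> s; rewrite map_cat cats1 rcons_uniq negb_and negbK -natr_sum -natrD ler_nat.
    case: (boolP (uniq _)) => _ /=; last by rewrite orbT.
    rewrite orbF add0n; case: (boolP (_ \in _)) => // /mapP [r rl E].
    rewrite (big_rem r) //= -E passes_level_vertex //.
  rewrite avgD avg_cst; last exact: card_perm_gt0.
  rewrite lerD2l avg_sum (eq_bigr (fun=> ('C(n, a)%:R)^-1)); last first.
    by move=> r _; rewrite prob_passes card_level_vertex.
  by rewrite big_const_seq count_predT iter_addr_0 sl mulr_natl.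
rewrite expectD expect_cst; last exact: card_perm_gt0.
apply: le_trans (_ : t%:R ^+ 2 / 'C(n, a)%:R + t%:R / 'C(n, a)%:R <= _); first by rewrite lerD2r.
rewrite -mulrDl ler_pM2r ?invr_gt0 // natrD.
have : (0 : R) <= t%:R by rewrite ler0n.
by nra.
Qed.

End Exposure.

(** * Filling the levels one after another *)

Section Filling.
Local Open Scope ring_scope.
Variables (R : realType) (n : nat) (eps : R).
Hypotheses (eps_gt0 : 0 < eps) (eps_le : eps <= 100^-1).
Implicit Types (s : 'S_n) (x y z : {set 'I_n}) (C S : {set {set 'I_n}}) (l : seq 'S_n).

Definition vacant x C := [set e in x | x :\ e \notin C].

Definition vacant_below x C : {set {set 'I_n}} := [set x :\ e | e in vacant x C].

(** A local form of density: vacancies of level [k] are controlled below each single vertex of level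
    [k+1], which is what the induction consumes. *)
Definition level_supported k C : Prop :=
  forall x, #|x| = k.+1 -> #|vacant x C|%:R <= 2 * eps * k.+1%:R.

Lemma card_vacant x C : (#|vacant x C| + #|[set e in x | x :\ e \in C]|)%N = #|x|.
Proof.
rewrite -(cardsID [set e | x :\ e \in C] x) addnC; congr (_ + _)%N; apply: eq_card => e.
  by rewrite !inE.
by rewrite !inE andbC.
Qed.

Lemma card_vacant_below x C : #|vacant_below x C| = #|vacant x C|.
Proof.
rewrite card_in_imset // => e f; rewrite !inE => /andP[ex _] /andP[fx _] E.
by apply/eqP; apply: contraT => ne; have := setD11 e x; rewrite E !inE ne ex.
Qed.

(** Double counting of pairs of a vacant vertex of level [k] and a vertex of level [k+1] above it:
    the former occurs [n-k] times, the latter at most [2 eps (k+1)] times, and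
    [(k+1) C(n,k+1) = (n-k) C(n,k)]. *)
Lemma level_supported_density k C : (k < n)%N -> level_supported k C ->
  (1 - 2 * eps) * 'C(n, k)%:R <= (level_count C k)%:R.
Proof.
move=> kn h.
pose V := [set y : {set 'I_n} | (#|y| == k) && (y \notin C)].
have cV : (level_count C k + #|V|)%N = 'C(n, k).
  rewrite -[X in 'C(X, k)]card_ord -card_draws -[RHS](cardsID C) /level_count.
  by congr (_ + _)%N; apply: eq_card => y; rewrite !inE andbC.
have dc : (\sum_(x : {set 'I_n} | #|x| == k.+1) #|vacant x C| = (n - k) * #|V|)%N.
  transitivity (\sum_(x : {set 'I_n} | #|x| == k.+1) \sum_(e | e \in vacant x C) 1)%N.
    by apply: eq_bigr => x _; rewrite sum1_card.
  rewrite (exchange_big_dep predT) //=.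
  transitivity (\sum_(e : 'I_n) \sum_(y : {set 'I_n} | (y \in V) && (e \notin y)) 1)%N.
    apply: eq_bigr => e _.
    rewrite (reindex_onto (fun y => e |: y) (fun x => x :\ e)) /=; last first.
      by move=> x; rewrite !inE => /andP[_ /andP[ex _]]; rewrite setD1K.
    apply: eq_bigl => y; rewrite !inE eqxx /=.
    case: (boolP (e \in y)) => ey; rewrite /= ?andbF.
      apply/negbTE; rewrite !negb_and; apply/orP; right.
      by apply/eqP => E; have := setD11 e (e |: y); rewrite E ey.
    by rewrite setU1K // cardsU1 ey add1n eqSS eqxx !andbT.
  rewrite (exchange_big_dep (fun y => y \in V)) /=; last by move=> e y _ /andP[].
  rewrite mulnC -sum_nat_const; apply: eq_bigr => y; rewrite inE => /andP[/eqP yk yC].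
  rewrite (eq_bigl (fun e => e \in ~: y)); last by move=> e; rewrite !inE yk eqxx yC.
  by rewrite sum1_card cardsCs setCK card_ord yk.
have ineq : ((n - k) * #|V|)%:R <= 2 * eps * ((n - k) * 'C(n, k))%:R.
  rewrite -dc natr_sum -mul_bin_left natrM mulrA mulr_natr.
  rewrite -[X in 'C(X, _)]card_ord -card_draws -sumr_const.
  rewrite [X in _ <= X](eq_bigl (fun x : {set 'I_n} => #|x| == k.+1)); last first.
    by move=> x; rewrite inE.
  by apply: ler_sum => x /eqP /h.
have nk : (0 : R) < (n - k)%:R by rewrite ltr0n subn_gt0.
rewrite !natrM mulrCA ler_pM2l // in ineq.
have : (level_count C k)%:R + #|V|%:R = 'C(n, k)%:R :> R by rewrite -natrD cV.
lra.
Qed.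

Lemma level_supported0 C : set0 \in C -> level_supported 0 C.
Proof.
move=> C0' x /eqP /cards1P [e ->].
suff -> : vacant [set e] C = set0 by rewrite cards0 !mulr_ge0 // ltW.
apply/setP => f; rewrite !inE; apply/negbTE; rewrite negb_and negbK.
by case: eqVneq => //= ->; rewrite setDv.
Qed.

Definition fill_time k := ('C(n, k.+1) %/ 16)%N.
Definition cap := (n %/ 10)%N.

(** The event of [prob_avoid] read off one sequence: support is tested at [t1], vacancy and blocking
    at [t2]. *)
Definition persists t1 t2 S l :=
  [&& [forall y in S, half_supported y (cluster (take t1 l))],
      [disjoint S & cluster (take t2 l)] &
      [forall y in S, blocking R y (cluster (take t2 l)) <= 2^-1]].

Definition collides k l := ~~ uniq [seq level_vertex s cap | s <- take (fill_time k) l].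

Definition overexposed k y l := 2^-1 < \sum_(s <- take (fill_time k) l) exposure R cap y s.

(** If [x] had too many vacant lower neighbours, [vacant_below x] would be an excluded persisting
    set: the previous level gives it half support, and the absence of collisions and of overexposed
    vertices keeps its blocking small. *)
Lemma level_supported_step k l : (0 < cap)%N -> (0 < k)%N ->
  level_supported k.-1 (cluster (take (fill_time k.-1) l)) ->
  ~~ collides k l -> (forall y, #|y| = k -> ~~ overexposed k y l) ->
  (forall x S, #|x| = k.+1 -> S \subset [set x :\ e | e in x] ->
     2 * eps * k.+1%:R < #|S|%:R -> ~~ persists (fill_time k.-1) (fill_time k) S l) ->
  level_supported k (cluster (take (fill_time k) l)).
Proof.
move=> a0 k0 IH /negPn nc ne np x xk; rewrite leNgt; apply/negP => lt.
set C := cluster (take (fill_time k) l) in lt *.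
have sub : vacant_below x C \subset [set x :\ e | e in x].
  by apply: imsetS; apply/subsetP => e; rewrite inE => /andP[].
have cS : forall y, y \in vacant_below x C -> #|y| = k /\ y \notin C.
  move=> y /imsetP[e]; rewrite inE => /andP[ex nC] ->; split => //.
  by rewrite card_setD1 // xk.
have big : 2 * eps * k.+1%:R < #|vacant_below x C|%:R by rewrite card_vacant_below.
have := np x _ xk sub big; rewrite /persists -/C => /negP; apply; apply/and3P; split.
- apply/forallP => y; apply/implyP => /cS [yk _].
  have := IH y; rewrite prednK // => /(_ yk) le.
  rewrite /half_supported -(card_vacant y (cluster (take (fill_time k.-1) l))).
  set v := #|vacant y _| in le *; have hv : (2 * v <= k)%N.
    rewrite -(ler_nat R) natrM; have k0' : (0 : R) <= k%:R by rewrite ler0n.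
    by have := ler_wpM2r k0' eps_le; lra.
  have := card_vacant y (cluster (take (fill_time k.-1) l)); rewrite -/v yk.
  by set w := #|_|; lia.
- rewrite disjoints_subset; apply/subsetP => y /cS [_]; by rewrite inE.
- apply/forallP => y; apply/implyP => /cS [yk _].
  have := ne y yk; rewrite /overexposed -leNgt; apply: le_trans.
  apply: blocking_cluster_le => z; apply: card_cluster_le => //.
  by rewrite a0 /cap leq_div.
Qed.

(** Condition on the first [t1] walks: either half support fails and the event is impossible, or
    [prob_avoid] handles the remaining [t2 - t1] walks. *)
Lemma prob_persists k t1 t2 T S : (0 < k)%N -> (t1 <= t2 <= T)%N ->
  (forall y, y \in S -> #|y| = k) ->
  expect T (fun l => (persists t1 t2 S l)%:R) <=
  expR (- (#|S|%:R / (4 * 'C(n, k))%:R * (t2 - t1)%:R)) :> R.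
Proof.
move=> k0 /andP[t12 t2T] hS.
pose F l : R := (persists t1 t2 S l)%:R.
have -> : expect T (fun l => (persists t1 t2 S l)%:R) = expect T (fun l => F (take t2 l)).
  apply: eq_expect; first exact: card_perm_gt0.
  by move=> l _; rewrite /F /persists !take_takel.
rewrite expect_take //; last exact: card_perm_gt0.
rewrite -[X in expect X _](subnKC t12) expect_cat.
rewrite -[X in _ <= X](expect_cst (card_perm_gt0 n) t1).
apply: le_expect; first exact: card_perm_gt0.
move=> l sl; rewrite -mulNr expRM_natr.
case: (boolP [forall y in S, half_supported y (cluster l)]) => [hs|nhs].
  apply: le_trans (prob_avoid R (C := cluster l) _ k0 _); last first.
    by move=> y yS; split; [apply: hS | move/forallP: hs => /(_ y) /implyP; apply].
  apply: le_expect; first exact: card_perm_gt0.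
  move=> l' sl'; rewrite /F /persists take_size_cat // hs take_oversize; last first.
    by rewrite size_cat sl sl'; lia.
  by rewrite /cluster foldl_cat.
apply: le_trans (_ : 0 <= _); last by rewrite exprn_ge0 ?expR_ge0.
rewrite -[X in _ <= X](expect_cst (card_perm_gt0 n) (t2 - t1)).
apply: le_expect; first exact: card_perm_gt0.
by move=> l' _; rewrite /F /persists take_size_cat // (negbTE nhs).
Qed.

(** The size of [S] cancels the factor [k+1] in the available time: [2 eps (k+1)/4] times
    [n/(32(k+1))] is [eps n/64]. *)
Lemma prob_persists_large k T x S : (0 < k)%N -> (1000 * k.+1 <= n)%N ->
  (fill_time k <= T)%N -> #|x| = k.+1 -> S \subset [set x :\ e | e in x] ->
  2 * eps * k.+1%:R < #|S|%:R ->
  expect T (fun l => (persists (fill_time k.-1) (fill_time k) S l)%:R) <=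
  expR (- (eps * n%:R / 64)) :> R.
Proof.
move=> k0 kn kT xk sub big.
have b0 : (0 < 'C(n, k))%N by rewrite bin_gt0; lia.
have E := mul_bin_left n k.
have t12 : (fill_time k.-1 <= fill_time k)%N.
  rewrite /fill_time prednK //; apply: leq_div2r.
  by have := @bin_double n k; lia.
(* The gap is about [C(n,k+1)/16 = (n-k) C(n,k)/(16(k+1))]. Since [1000(k+1) <= n], passing from 16
   to 32 absorbs the rounding, the subtracted [C(n,k)] and the change from [n-k] to [n]. *)
have D : (n * 'C(n, k) <= 32 * k.+1 * (fill_time k - fill_time k.-1))%N.
  move: t12; rewrite /fill_time prednK // => t12.
  have h1 := divn_eq 'C(n, k.+1) 16; have h2 := divn_eq 'C(n, k) 16.
  have h3 : ('C(n, k.+1) %% 16 < 16)%N by apply: ltn_mod.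
  set d1 := ('C(n, k.+1) %/ 16)%N in h1 t12 *; set d2 := ('C(n, k) %/ 16)%N in h2 t12 *.
  have h4 : ('C(n, k.+1) <= 16 * (d1 - d2) + 15 + 'C(n, k))%N by lia.
  have h5 : ((n - k) * 'C(n, k) <= k.+1 * (16 * (d1 - d2)) + 16 * k.+1 * 'C(n, k))%N.
    rewrite -E; apply: leq_trans (leq_mul (leqnn k.+1) h4) _; nia.
  have h6 : (n * 'C(n, k) + 32 * k.+1 * 'C(n, k) <= 2 * ((n - k) * 'C(n, k)))%N.
    rewrite mulnA -mulnDl; apply: leq_mul => //; lia.
  nia.
apply: le_trans (prob_persists k0 _ _) _; first by rewrite t12.
  move=> y /(subsetP sub) /imsetP [e ex ->]; by rewrite card_setD1 // xk.
rewrite ler_expR lerN2.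
set d := (fill_time k - fill_time k.-1)%N in D *.
have b0' : (0 : R) < 'C(n, k)%:R by rewrite ltr0n.
have D' : n%:R * 'C(n, k)%:R <= 32 * k.+1%:R * d%:R :> R by rewrite -!natrM ler_nat.
have d0 : (0 : R) <= d%:R by rewrite ler0n.
have -> : #|S|%:R / (4 * 'C(n, k))%:R * d%:R = #|S|%:R * (d%:R / 'C(n, k)%:R) / 4 :> R.
  by rewrite natrM; field; rewrite gt_eqF.
have h1 : n%:R <= 32 * k.+1%:R * (d%:R / 'C(n, k)%:R) :> R by rewrite mulrA ler_pdivlMr.
have h2 : (0 : R) <= d%:R / 'C(n, k)%:R by rewrite divr_ge0 // ltW.
have h3 := ler_wpM2r h2 (ltW big).
have := ler_wpM2l (ltW eps_gt0) h1; lra.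
Qed.

End Filling.

(** * Union bound *)

Lemma exp2_le_bin m i : 3 * i <= m.+1 -> 2 ^ i <= 'C(m, i).
Proof.
elim: i => [|i IH] h; first by rewrite bin0.
by rewrite expnS; apply: leq_trans (bin_double _); rewrite ?leq_mul2l /= ?IH //; lia.
Qed.

Lemma bin_le_exp2 m i : 'C(m, i) <= 2 ^ m.
Proof.
rewrite -[m in X in _ <= X]card_ord -cardsT -card_powerset -[m in 'C(m, i)]card_ord.
by rewrite -card_draws; apply: subset_leq_card; apply/subsetP => A _; rewrite powersetE subsetT.
Qed.

Lemma cap_bounds n : 10 * cap n <= n < 10 * cap n + 10.
Proof.
rewrite /cap mulnC leq_trunc_div /= {1}(divn_eq n 10) ltn_add2l.
exact: ltn_mod.
Qed.

Section Probability.
Local Open Scope ring_scope.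
Variables (R : realType) (n : nat) (eps : R).
Hypotheses (eps_gt0 : 0 < eps) (eps_le : eps <= 100^-1).
Hypothesis n_large : 1 <= eps ^+ 3 * n%:R.
Implicit Types (s : 'S_n) (x y z : {set 'I_n}) (C S : {set {set 'I_n}}) (l : seq 'S_n).

(** Weighted binomial theorem: [C(n,j) u^j <= (1+u)^n <= exp(u n)]. The remaining factor [(2/u)^j]
    is affordable because [j <= 2 eps^3 n]. *)
Lemma bin_exp2_le_expR j : j%:R <= 2 * eps ^+ 3 * n%:R ->
  'C(n, j)%:R * 2 ^+ j <= expR (eps * n%:R / 100) :> R.
Proof.
move=> hj; pose u := eps / 200.
have u0 : 0 < u by rewrite divr_gt0.
have h1 : 'C(n, j)%:R * u ^+ j <= expR (u * n%:R).
  apply: le_trans (_ : (1 + u) ^+ n <= _); last first.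
    by rewrite expRM_natr; apply: lerXn2r; rewrite ?nnegrE ?expR_ge0 ?expR_ge1Dx // addr_ge0 // ltW.
  have [jn|nj] := leqP j n; last first.
    by rewrite bin_small // mul0r exprn_ge0 // addr_ge0 // ltW.
  rewrite exprDn (bigD1 (Ordinal (n := n.+1) (m := j) jn)) //= expr1n mul1r mulr_natl lerDl.
  apply: sumr_ge0 => i _; rewrite expr1n mul1r; apply: mulrn_wge0.
  by apply: exprn_ge0; apply: ltW.
pose v := eps^-1.
have v0 : 0 < v by rewrite invr_gt0.
have v100 : 100 <= v by rewrite -[100]invrK /v lef_pV2 ?posrE ?invr_gt0.
(* The degree-6 Taylor term suffices for [v >= 100]. The exponent is quadratic in [v], so
   multiplying it by [2 eps^3 n] leaves [eps n/200]. *)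
have h2 : 2 / u <= expR (v ^+ 2 / 400).
  have x0 : 0 <= v ^+ 2 / 400 by rewrite divr_ge0 // exprn_ge0 // ltW.
  apply: le_trans (expR_ge1Dxn 5 x0).
  have -> : 2 / u = 400 * v by rewrite /u /v; field; rewrite gt_eqF.
  have -> : 6`!%:R = 720 :> R by [].
  have : 100 ^+ 11 <= v ^+ 11 by apply: lerXn2r; rewrite ?nnegrE // ltW.
  move=> /(ler_wpM2r (ltW v0)); rewrite -exprSr => h.
  have -> : (v ^+ 2 / 400) ^+ 6 / 720 = v ^+ 12 / (720 * 400 ^+ 6).
    by field.
  rewrite -[X in X <= _]add0r; apply: lerD => //.
  have pos : (0 : R) < 720 * 400 ^+ 6 by lra.
  rewrite ler_pdivlMr //.
  apply: le_trans h; rewrite mulrAC ler_pM2r //.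
  lra.
have -> : 'C(n, j)%:R * 2 ^+ j = 'C(n, j)%:R * u ^+ j * (2 / u) ^+ j.
  by rewrite -mulrA -exprMn mulrCA divff ?mulr1 // gt_eqF.
apply: le_trans (_ : expR (u * n%:R) * expR (v ^+ 2 / 400) ^+ j <= _).
  have q0 : 0 <= 2 / u by rewrite divr_ge0 // ltW.
  apply: ler_pM => //; first by rewrite mulr_ge0 ?ler0n // exprn_ge0 // ltW.
    exact: exprn_ge0.
  by apply: lerXn2r; rewrite ?nnegrE ?expR_ge0.
rewrite -expRM_natr -expRD ler_expR.
have : v ^+ 2 / 400 * j%:R <= v ^+ 2 / 400 * (2 * eps ^+ 3 * n%:R).
  by apply: ler_wpM2l => //; rewrite divr_ge0 // exprn_ge0 // ltW.
have -> : v ^+ 2 / 400 * (2 * eps ^+ 3 * n%:R) = eps * n%:R / 200.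
  by rewrite /v; field; rewrite gt_eqF.
rewrite /u; lra.
Qed.

Definition low_level k := (k%:R < eps ^+ 3 * n%:R).

Lemma eps3_le : eps ^+ 3 <= 100^-1 * 100^-1 * 100^-1.
Proof.
have -> : 100^-1 * 100^-1 * 100^-1 = (100^-1) ^+ 3 :> R by rewrite exprSr expr2.
by apply: lerXn2r; rewrite ?nnegrE ?invr_ge0 ?(ltW eps_gt0).
Qed.

Lemma low_level_bound k : low_level k -> (1000 * k.+1 <= n)%N.
Proof.
move=> h; rewrite -(ler_nat R) natrM -[k.+1%:R]natr1.
have n0 : (0 : R) <= n%:R by rewrite ler0n.
have := ler_wpM2r n0 eps3_le; move: h n_large; rewrite /low_level.
set w := eps ^+ 3 * n%:R; move: w => w h1 h2 h3.
have h4 : w * 1000 <= n%:R / 1000 by lra.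
lra.
Qed.

Lemma low_level_double k : low_level k -> k.+1%:R <= 2 * eps ^+ 3 * n%:R.
Proof. by rewrite /low_level -[k.+1%:R]natr1 -mulrA; move: n_large; set w := eps ^+ 3 * n%:R; lra. Qed.

Definition levels_filled l :=
  [forall k : 'I_n.+1, low_level k ==>
     ((1 - 2 * eps) * 'C(n, k)%:R <= (level_count (cluster l) k)%:R)].

(** Bad events are counted rather than joined by a disjunction, so that the union bound becomes
    linearity of [expect]. *)
Definition obstructions k l : nat :=
  (collides k l + \sum_(y : {set 'I_n} | #|y| == k) overexposed R k y l +
   \sum_(x : {set 'I_n} | #|x| == k.+1)
     \sum_(S : {set {set 'I_n}} | (S \subset [set x :\ e | e in x]) &&
        (2 * eps * k.+1%:R < #|S|%:R)%R)
       persists R (fill_time n k.-1) (fill_time n k) S l)%N.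

(** Without obstructions, [level_supported_step] climbs from level 0, which is supported because
    [set0] is occupied; hence the sum starts at [k = 1]. *)
Lemma levels_filledP l :
  (~~ levels_filled l <= \sum_(k < n.+1 | (0 < k)%N && low_level k) obstructions k l)%N.
Proof.
have [B0|B0] := posnP (\sum_(k < n.+1 | (0 < k)%N && low_level k) obstructions k l)%N;
  last by apply: leq_trans B0; apply: leq_b1.
rewrite B0 leqn0 eqb0 negbK.
have n1000 : (1000 <= n)%N.
  have := @low_level_bound 0%N; rewrite muln1; apply.
  by apply: lt_le_trans n_large; apply: ltr01.
have a0 : (0 < cap n)%N by rewrite divn_gt0 //; lia.
have noobs k : (0 < k)%N -> low_level k -> obstructions k l = 0%N.
  move=> k0 ok; have kn := low_level_bound ok.
  have kn1 : (k < n.+1)%N by lia.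
  move/eqP: B0; rewrite sum_nat_eq0 => /forallP /(_ (Ordinal kn1)) /implyP /=.
  by rewrite k0 ok => /(_ isT) /eqP.
have sup k : low_level k -> level_supported eps k (cluster (take (fill_time n k) l)).
  elim: k => [|k IH] ok; first by apply: level_supported0 => //; apply: set0_cluster.
  have ok' : low_level k.
    by apply: le_lt_trans ok; rewrite ler_nat.
  move/eqP: (noobs k.+1 isT ok); rewrite /obstructions !addn_eq0 -andbA => /and3P[n1 n2 n3].
  apply: level_supported_step => //.
  - exact: IH.
  - by rewrite -eqb0.
  - move=> y yk; move: n2; rewrite sum_nat_eq0 => /forallP /(_ y) /implyP.
    by rewrite yk eqxx eqb0 => /(_ isT).
  - move=> x S xk sub big; move: n3; rewrite sum_nat_eq0 => /forallP /(_ x) /implyP.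
    rewrite xk eqxx sum_nat_eq0 => /(_ isT) /forallP /(_ S) /implyP.
    by rewrite sub big eqb0 => /(_ isT).
apply/forallP => k; apply/implyP => ok.
have kn : (k < n)%N by have := low_level_bound ok; lia.
apply: le_trans (level_supported_density kn (sup _ ok)) _.
(* Occupied vertices stay occupied, so the density reached at [fill_time] survives. *)
rewrite ler_nat; apply: subset_leq_card; apply/subsetP => y; rewrite !inE => /andP[yC ->].
by rewrite andbT; apply: (subsetP (sub_cluster_take _ _)) yC.
Qed.

Lemma exp2_ge_expR a : expR (a%:R / 2) <= 2 ^+ a :> R.
Proof.
rewrite mulrC expRM_natr; apply: lerXn2r; rewrite ?nnegrE ?expR_ge0 //.
by have := @expR_le1D2x R 2^-1; lra.
Qed.

Lemma expect_obstructions k : (0 < k)%N -> low_level k ->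
  expect (2 ^ n) (fun l => (obstructions k l)%:R) <= 3 * expR (- (eps * n%:R / 200)) :> R.
Proof.
move=> k0 ok; have kn := low_level_bound ok.
have /andP[capl capu] := cap_bounds n.
have tT : (fill_time n k <= 2 ^ n)%N.
  by apply: leq_trans (leq_div _ _) (bin_le_exp2 _ _).
(* [M] bounds the number of pairs of a vertex of level [k+1] and a set of its lower neighbours,
   hence also [C(n,k+1)] and [C(n,k)]. *)
pose M : R := expR (eps * n%:R / 100).
have M1 : 'C(n, k.+1)%:R * 2 ^+ k.+1 <= M by apply/bin_exp2_le_expR/low_level_double.
have pow1 i : 1 <= 2 ^+ i :> R by apply: exprn_ege1; rewrite ler1n.
have M2 : 'C(n, k.+1)%:R <= M by apply: le_trans M1; rewrite ler_peMr ?ler0n.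
have M3 : 'C(n, k)%:R <= M.
  apply: le_trans M2; rewrite ler_nat; have := @bin_double n k; lia.
have n0 : (0 : R) <= n%:R by rewrite ler0n.
have n1000 : 1000 <= n%:R :> R by rewrite ler_nat; lia.
have en : 0 <= eps * n%:R by rewrite mulr_ge0 // ltW.
have en2 : eps * n%:R <= 100^-1 * n%:R by apply: ler_wpM2r.
have -> : expect (2 ^ n) (fun l => (obstructions k l)%:R) =
   expect (2 ^ n) (fun l => (collides k l)%:R) +
   \sum_(y : {set 'I_n} | #|y| == k) expect (2 ^ n) (fun l => (overexposed R k y l)%:R) +
   \sum_(x : {set 'I_n} | #|x| == k.+1)
     \sum_(S : {set {set 'I_n}} | (S \subset [set x :\ e | e in x]) &&
        (2 * eps * k.+1%:R < #|S|%:R)%R)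
      expect (2 ^ n) (fun l => (persists R (fill_time n k.-1) (fill_time n k) S l)%:R) :> R.
  transitivity (expect (2 ^ n) (fun l => (collides k l)%:R +
     \sum_(y : {set 'I_n} | #|y| == k) (overexposed R k y l)%:R +
     \sum_(x : {set 'I_n} | #|x| == k.+1)
       \sum_(S : {set {set 'I_n}} | (S \subset [set x :\ e | e in x]) &&
          (2 * eps * k.+1%:R < #|S|%:R)%R)
        (persists R (fill_time n k.-1) (fill_time n k) S l)%:R) : R).
    apply: eq_expect; first exact: card_perm_gt0.
    move=> l _; rewrite /obstructions !natrD !natr_sum; congr (_ + _).
    by apply: eq_bigr => x _; rewrite natr_sum.
  rewrite !expectD !expect_sum; congr (_ + _).
  by apply: eq_bigr => x _; rewrite expect_sum.
have P1 : expect (2 ^ n) (fun l => (collides k l)%:R) <= expR (- (eps * n%:R / 200)) :> R.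
  rewrite (expect_take (card_perm_gt0 n)
    (fun l => (~~ uniq [seq level_vertex s (cap n) | s <- l])%:R) tT).
  have capn : (cap n <= n)%N by apply: leq_div.
  apply: le_trans (prob_collision R _ capn) _.
  have c0 : (0 : R) < 'C(n, cap n)%:R by rewrite ltr0n bin_gt0.
  rewrite ler_pdivrMr //.
  have t0 : (fill_time n k)%:R <= M.
    by apply: le_trans M2; rewrite ler_nat; apply: leq_div.
  apply: le_trans (_ : M ^+ 2 <= _).
    by apply: lerXn2r; rewrite ?nnegrE ?expR_ge0 ?ler0n.
  (* [M^2 = exp(eps n/50)] is far below [C(n,cap) >= 2^cap >= exp(cap/2)], as [cap] is about
     [n/10]. *)
  apply: le_trans (_ : expR (- (eps * n%:R / 200)) * expR ((cap n)%:R / 2) <= _); last first.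
    rewrite ler_pM2l ?expR_gt0 //; apply: le_trans (exp2_ge_expR _) _.
    rewrite -natrX ler_nat; apply: exp2_le_bin.
    by move: capl; clear; set c := cap n; lia.
  rewrite -expRM_natl -expRD ler_expR.
  have : n%:R <= 10 * (cap n)%:R + 10 :> R.
    by rewrite -natrM -natrD ler_nat ltnW.
  lra.
have P2 : \sum_(y : {set 'I_n} | #|y| == k) expect (2 ^ n) (fun l => (overexposed R k y l)%:R)
    <= expR (- (eps * n%:R / 200)) :> R.
  apply: le_trans (_ : \sum_(y : {set 'I_n} | #|y| == k) expR (- (n%:R / 32)) <= _).
    apply: ler_sum => y /eqP yk.
    rewrite (expect_take (card_perm_gt0 n)
      (fun l => (2^-1 < \sum_(s <- l) exposure R (cap n) y s)%R%:R) tT).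
    apply: le_trans (prob_exposure_gt R capl _ _) _.
    - by rewrite yk; move: capu kn; clear; set c := cap n; lia.
    - by rewrite yk mulnC; apply: leq_trunc_div.
    rewrite ler_expR lerN2 yk.
    have : n%:R <= 2 * (n - k)%:R :> R by rewrite -natrM ler_nat; move: kn; clear; lia.
    lra.
  rewrite (eq_bigl (fun y : {set 'I_n} => y \in [set A : {set 'I_n} | #|A| == k])); last first.
    by move=> y; rewrite inE.
  rewrite sumr_const card_draws card_ord -[X in X <= _]mulr_natl.
  apply: le_trans (_ : M * expR (- (n%:R / 32)) <= _).
    by rewrite ler_pM2r ?expR_gt0.
  rewrite -expRD ler_expR; lra.
have P3 : \sum_(x : {set 'I_n} | #|x| == k.+1)
     \sum_(S : {set {set 'I_n}} | (S \subset [set x :\ e | e in x]) &&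
        (2 * eps * k.+1%:R < #|S|%:R)%R)
      expect (2 ^ n) (fun l => (persists R (fill_time n k.-1) (fill_time n k) S l)%:R)
    <= expR (- (eps * n%:R / 200)) :> R.
  apply: le_trans (_ : \sum_(x : {set 'I_n} | #|x| == k.+1)
      2 ^+ k.+1 * expR (- (eps * n%:R / 64)) <= _).
    apply: ler_sum => x /eqP xk.
    apply: le_trans (_ : \sum_(S in powerset [set x :\ e | e in x])
        expR (- (eps * n%:R / 64)) <= _); last first.
      rewrite sumr_const card_powerset -[X in X <= _]mulr_natl ler_pM2r ?expR_gt0 //.
      rewrite natrX; apply: ler_weXn2l => //; first by rewrite ler1n.
      by rewrite -xk; apply: leq_imset_card.
    rewrite [X in _ <= X](eq_bigl (fun S => S \subset [set x :\ e | e in x])); last first.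
      by move=> S; rewrite powersetE.
    rewrite big_mkcondr; apply: ler_sum => S sub; case: ifP => [big|_]; last exact: expR_ge0.
    exact: (prob_persists_large eps_gt0 eps_le k0 kn tT xk sub big).
  rewrite (eq_bigl (fun y : {set 'I_n} => y \in [set A : {set 'I_n} | #|A| == k.+1])); last first.
    by move=> y; rewrite inE.
  rewrite sumr_const card_draws card_ord -[X in X <= _]mulr_natl mulrA.
  (* The margin [1/64 - 1/100 > 1/200] allows the final rate. *)
  apply: le_trans (_ : M * expR (- (eps * n%:R / 64)) <= _).
    by rewrite ler_pM2r ?expR_gt0.
  rewrite -expRD ler_expR; lra.
lra.
Qed.

Lemma prob_levels_filled :
  1 - 3 * n.+1%:R * expR (- (eps * n%:R / 200)) <=
  expect (2 ^ n) (fun l => (levels_filled l)%:R) :> R.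
Proof.
rewrite lerBlDl.
apply: le_trans (_ : expect (2 ^ n) (fun l => (~~ levels_filled l)%:R) +
   expect (2 ^ n) (fun l => (levels_filled l)%:R) <= _).
  rewrite -expectD -[X in X <= _](expect_cst (card_perm_gt0 n) (2 ^ n)); apply: le_expect.
    exact: card_perm_gt0.
  by move=> l _; rewrite -natrD; case: levels_filled.
rewrite lerD2r.
apply: le_trans (_ : expect (2 ^ n) (fun l =>
    \sum_(k < n.+1 | (0 < k)%N && low_level k) (obstructions k l)%:R) <= _).
  apply: le_expect; first exact: card_perm_gt0.
  by move=> l _; rewrite -natr_sum ler_nat levels_filledP.
rewrite expect_sum big_mkcond.
apply: le_trans (_ : \sum_(k < n.+1) 3 * expR (- (eps * n%:R / 200)) <= _).
  apply: ler_sum => k _; case: ifP => [/andP[k0 ok]|_]; first exact: expect_obstructions.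
  by rewrite mulr_ge0 // expR_ge0.
by rewrite sumr_const card_ord -[X in X <= _]mulr_natl mulrCA mulrA.
Qed.

End Probability.

(** * Asymptotics *)

Section Eventually.
Local Open Scope ring_scope.

Lemma linear_expR_small (R : realType) (c delta : R) : 0 < c -> 0 < delta ->
  exists N : nat, forall n, (N <= n)%N -> 3 * n.+1%:R * expR (- (c * n%:R)) <= delta.
Proof.
(* By [exp(x) >= 1 + x^2/2] it is enough that [3(n+1) <= 6n <= delta c^2 n^2/2], which holds once
   [n >= B] and [n >= 1]. *)
move=> c0 d0; pose B := 12 / (c ^+ 2 * delta).
have B0 : 0 <= B by rewrite divr_ge0 // mulr_ge0 ?exprn_ge0 // ltW.
exists (Num.bound B).+1 => n Nn.
have nB : B <= n%:R.
  apply: ltW; apply: lt_le_trans (archi_boundP B0) _; rewrite ler_nat; lia.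
have n1 : 1 <= n%:R :> R by rewrite ler1n; lia.
have n0 : 0 < n%:R :> R by lra.
have cn : 0 <= c * n%:R by rewrite mulr_ge0 // ltW.
have e0 := expR_gt0 (c * n%:R).
rewrite expRN ler_pdivrMr // -natr1.
have /(ler_wpM2l (ltW d0)) := expR_ge1Dxn 1 cn; apply: le_trans.
have : 12 <= n%:R * (c ^+ 2 * delta) by rewrite -ler_pdivrMr // mulr_gt0 // exprn_gt0.
rewrite (_ : 2`!%:R = 2 :> R) // => h.
have -> : delta * (1 + (c * n%:R) ^+ 2 / 2) = delta + n%:R * (n%:R * (c ^+ 2 * delta)) / 2.
  by field.
have := ler_wpM2l (ltW n0) h; lra.
Qed.

(** * Translation of the stated event and its probability into [expect] *)

Lemma RlebE (a b : Rdefinitions.R) : Defs.Rleb a b = (a <= b).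
Proof.
rewrite /Defs.Rleb; case: (Rle_dec a b) => h.
  by symmetry; apply/RleP.
by symmetry; apply/negbTE; apply/negP => /RleP.
Qed.

Lemma RltbE (a b : Rdefinitions.R) : Defs.Rltb a b = (a < b).
Proof.
rewrite /Defs.Rltb; case: (Rlt_dec a b) => h.
  by symmetry; apply/RltP.
by symmetry; apply/negbTE; apply/negP => /RltP.
Qed.

Lemma good_probE n (eps : Rdefinitions.R) :
  good_prob n eps = expect (2 ^ n) (fun l : seq 'S_n => (levels_filled eps l)%:R).
Proof.
rewrite -expect_ffun.
rewrite /good_prob RdivE !INRE; congr (_%:R / _); apply: eq_card => w; rewrite !inE.
apply: eq_forallb => k; rewrite RltbE RlebE /low_level.
by rewrite !(RmultE, RminusE, INRE, RpowE).
Qed.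

End Eventually.

Theorem theorem3 (eps : R) :
  Rlt 0 eps -> Rle eps (Rdiv 1 100) ->
  forall delta : R, Rlt 0 delta ->
  exists N : nat, forall n : nat, N <= n ->
    Rle (Rminus 1 delta) (good_prob n eps).
Proof.
move=> /RltP eps0 /RleP eps1 delta /RltP delta0.
have eps1' : (eps <= 100^-1)%R.
  by move: eps1; rewrite RdivE R1E IZRposE INRE div1r.
have c0 : (0 < eps / 200)%R by rewrite divr_gt0.
have [N1 h1] := linear_expR_small c0 delta0.
have e3 : (0 < eps ^+ 3)%R by rewrite exprn_gt0.
have B0 : (0 <= (eps ^+ 3)^-1)%R by rewrite invr_ge0 ltW.
(* The first bound makes the total failure probability at most [delta]; the second gives
   [1 <= eps^3 n], the assumption [n_large]. *)
exists (maxn N1 (Num.bound (eps ^+ 3)^-1)%R) => n; rewrite geq_max => /andP[n1 n2].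
have nl : (1 <= eps ^+ 3 * n%:R)%R.
  rewrite mulrC -ler_pdivrMr // div1r ltW //; apply: lt_le_trans (archi_boundP B0) _.
  by rewrite ler_nat.
apply/RleP; rewrite good_probE RminusE R1E.
apply: le_trans (prob_levels_filled eps0 eps1' nl).
rewrite lerD2l lerN2; have := h1 n n1.
by rewrite [(eps / 200 * _)%R]mulrAC.
Qed.
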